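(* Let $\alpha\in\mathbb{C}\setminus\mathbb{Q}$ and let $LG_{n}(\alpha)=\mathrm{End}_{U_q(sl(2|1))}\big(V(0,\alpha)^{\otimes n}\big)$. Then for every $n\in\mathbb{N}$, $$\dim_{\Bbbk} LG_{n+1}(\alpha)=\frac{(2n)!\,(2n+1)!}{(n!\,(n+1)!)^2}.$$
   Context: Let $\hbar$ be an indeterminate, $\Bbbk=\mathbb{C}((\hbar))$, $q=e^{\hbar/2}$, $q^{z}=e^{z\hbar/2}$ for $z\in\mathbb{C}$. Everything is $\mathbb{Z}/2$-graded (super) with the usual sign rule $(f\otimes g)(x\otimes y)=(-1)^{\bar g\bar x}f(x)\otimes g(y)$ and super-commutator $[x,y]=xy-(-1)^{\bar x\bar y}yx$. Let $(a_{ij})=\begin{pmatrix}2&-1\\-1&0\end{pmatrix}$. $U_q(sl(2|1))$ is the Hopf superalgebra over $\Bbbk$ generated by $E_i,F_i,h_i$ ($i=1,2$), with $E_2,F_2$ odd and the other generators even, with relations $[h_i,h_j]=0$, $[h_i,E_j]=a_{ij}E_j$, $[h_i,F_j]=-a_{ij}F_j$, $[E_i,F_j]=\delta_{ij}\frac{q^{h_i}-q^{-h_i}}{q-q^{-1}}$, $E_2^2=F_2^2=0$, $E_1^2E_2-(q+q^{-1})E_1E_2E_1+E_2E_1^2=0$, $F_1^2F_2-(q+q^{-1})F_1F_2F_1+F_2F_1^2=0$, and coproduct $\Delta(E_i)=E_i\otimes1+q^{-h_i}\otimes E_i$, $\Delta(F_i)=F_i\otimes q^{h_i}+1\otimes F_i$,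 $\Delta(h_i)=h_i\otimes1+1\otimes h_i$. Tensor powers of modules are modules via $\Delta$. A vector $v$ has weight $(\alpha_1,\alpha_2)$ if $h_iv=\alpha_iv$ for $i=1,2$ (and then $q^{h_i}v=q^{\alpha_i}v$); it is a highest weight vector if moreover $E_1v=E_2v=0$. For $(\alpha_1,\alpha_2)\in\mathbb{N}\times\mathbb{C}$, $V(\alpha_1,\alpha_2)$ denotes the finite-dimensional simple module generated by a highest weight vector of weight $(\alpha_1,\alpha_2)$ (unique up to isomorphism and parity shift). Here $\mathbb{N}=\{0,1,2,\dots\}$. *)

(* Defs.v *)
From HB Require Import structures.
From mathcomp Require Import all_boot all_order all_algebra.
From mathcomp Require Import boolp classical_sets reals.
From mathcomp Require Import complex mxtens.

Set Implicit Arguments.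
Unset Strict Implicit.
Unset Printing Implicit Defensive.

Import Order.TTheory GRing.Theory Num.Theory.
Local Open Scope ring_scope.

(* Formal power series K[[hbar]], given by their coefficients *)

Definition fps (K : fieldType) : Type := nat -> K.

Section PowerSeries.
Variable K : fieldType.
Implicit Types f g h : fps K.

HB.instance Definition _ := gen_eqMixin (fps K).
HB.instance Definition _ := gen_choiceMixin (fps K).

Definition fps0 : fps K := fun=> 0.
Definition fps_opp f : fps K := fun n => - f n.
Definition fps_add f g : fps K := fun n => f n + g n.
Definition fpsC (c : K) : fps K := fun n => if n == 0%N then c else 0.
Definition fps_mul f g : fps K := fun n => \sum_(i < n.+1) f i * g (n - i)%N.

Lemma fps_addA : associative fps_add.
Proof. by move=> f g h; apply/funext => n; rewrite /fps_add addrA. Qed.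
Lemma fps_addC : commutative fps_add.
Proof. by move=> f g; apply/funext => n; rewrite /fps_add addrC. Qed.
Lemma fps_add0 : left_id fps0 fps_add.
Proof. by move=> f; apply/funext => n; rewrite /fps_add add0r. Qed.
Lemma fps_addN : left_inverse fps0 fps_opp fps_add.
Proof. by move=> f; apply/funext => n; rewrite /fps_add addNr. Qed.

HB.instance Definition _ :=
  GRing.isZmodule.Build (fps K) fps_addA fps_addC fps_add0 fps_addN.

Lemma fps_mul_poly f g m n : (n < m)%N ->
  fps_mul f g n = ((\poly_(i < m) f i) * (\poly_(i < m) g i))`_n.
Proof.
move=> nm; rewrite coefM; apply: eq_bigr => i _; rewrite !coef_poly.
by rewrite (leq_ltn_trans _ nm) ?leq_ord // (leq_ltn_trans (leq_subr _ _) nm).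
Qed.

Lemma fps_mulC : commutative fps_mul.
Proof.
by move=> f g; apply/funext => n; rewrite !(@fps_mul_poly _ _ n.+1) // mulrC.
Qed.

Lemma fps_mulA : associative fps_mul.
Proof.
move=> f g h; apply/funext => n.
pose t f := \poly_(i < n.+1) f i : {poly K}.
transitivity ((t f * (t g * t h))`_n).
  rewrite coefM; apply: eq_bigr => i _.
  by rewrite coef_poly ltn_ord (@fps_mul_poly _ _ n.+1) // ltnS leq_subr.
rewrite mulrA coefM; apply: eq_bigr => i _.
by rewrite [in RHS](@fps_mul_poly _ _ n.+1) // coef_poly ltnS leq_subr.
Qed.

Lemma fps_mul1 : left_id (fpsC 1) fps_mul.
Proof.
move=> f; apply/funext => n; rewrite /fps_mul big_ord_recl /= subn0.
by rewrite /fpsC eqxx mul1r big1 ?addr0 // => i _; rewrite mul0r.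
Qed.

Lemma fps_mulDl : left_distributive fps_mul fps_add.
Proof.
move=> f g h; apply/funext => n; rewrite /fps_add /fps_mul -big_split /=.
by apply: eq_bigr => i _; rewrite mulrDl.
Qed.

Lemma fps1_neq0 : fpsC 1 != 0.
Proof.
by apply/eqP => /(congr1 (fun f : fps K => f 0%N)) /eqP; rewrite oner_eq0.
Qed.

HB.instance Definition _ := GRing.Zmodule_isComNzRing.Build (fps K)
  fps_mulA fps_mulC fps_mul1 fps_mulDl fps1_neq0.

Definition fps_unit : {pred fps K} := fun f => `[< exists g, g * f = 1 >].
Definition fps_inv f : fps K := xget f [set g | g * f = 1].

Lemma fps_mulVr : {in fps_unit, left_inverse 1 fps_inv *%R}.
Proof. by move=> f /asboolP[g gf]; rewrite /fps_inv; case: xgetP => [|/(_ g)]. Qed.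
Lemma fps_unitP f g : g * f = 1 -> fps_unit f.
Proof. by move=> gf; apply/asboolP; exists g. Qed.
Lemma fps_inv_out : {in [predC fps_unit], fps_inv =1 id}.
Proof.
move=> f /= /asboolP nuf; rewrite /fps_inv; case: xgetP => // g _ gf.
by case: nuf; exists g.
Qed.

HB.instance Definition _ := GRing.ComNzRing_hasMulInverse.Build (fps K)
  fps_mulVr fps_unitP fps_inv_out.

Lemma fps_integral f g : f * g = 0 -> (f == 0) || (g == 0).
Proof.
have low h : h != 0 -> exists2 n, h n != 0 & forall i, (i < n)%N -> h i = 0.
  move=> h0; have ex : exists n, h n != 0.
    apply: contra_notP (elimN eqP h0) => /forallNP hn.
    by apply/funext => n; apply/eqP/negPn/negP; exact: hn.
  case: (ex_minnP ex) => n hn nmin; exists n => // i iltn.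
  by apply/eqP; apply: contraTT iltn => /nmin; rewrite -leqNgt.
apply: contra_eqT; rewrite negb_or => /andP[/low[m fm fl] /low[n gn gl]].
apply/eqP => /(congr1 (fun f : fps K => f (m + n)%N)).
have -> : (f * g) (m + n)%N = f m * g n.
  have mlt : (m < (m + n).+1)%N by rewrite ltnS leq_addr.
  rewrite [LHS](bigD1 (Ordinal mlt)) //= addKn big1 ?addr0 // => i.
  rewrite -val_eqE /= neq_ltn => /orP[/fl->|lmi]; first by rewrite mul0r.
  by rewrite gl ?mulr0 // ltn_subLR ?leq_ord // ltn_add2r.
by move/eqP; rewrite mulf_eq0 (negPf fm) (negPf gn).
Qed.

HB.instance Definition _ :=
  GRing.ComUnitRing_isIntegral.Build (fps K) fps_integral.

End PowerSeries.

(* A finite-dimensional super vector space is k^d with a homogeneous standard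
   basis: p j is the parity of the j-th basis vector. Operators are matrices
   acting on column vectors on the left. *)

Section SuperAlgebra.
Variable k : fieldType.

Section Operators.
Variables (d : nat) (p : 'I_d -> bool).
Implicit Types x y : 'M[k]_d.

Definition hpart (b : bool) x : 'M[k]_d :=
  \matrix_(i, j) (if p i (+) p j == b then x i j else 0).

Definition homogeneous (b : bool) x : Prop := hpart b x = x.

(* bilinear extension of [x, y] = xy - (-1)^(|x||y|) yx *)
Definition scomm x y : 'M[k]_d :=
  \sum_(a : bool) \sum_(b : bool)
    (hpart a x *m hpart b y - (-1) ^+ (a && b) *: (hpart b y *m hpart a x)).

Definition parity_mx : 'M[k]_d := \matrix_(i, j) ((-1) ^+ p i *+ (i == j)).

Lemma hpart_is_linear b : linear (hpart b).
Proof.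
move=> c x y; apply/matrixP => i j; rewrite !mxE.
by case: ifP => // _; rewrite mulr0 addr0.
Qed.

Lemma scomm_is_linear x : linear (scomm x).
Proof.
move=> c y z; rewrite /scomm scaler_sumr -big_split /=; apply: eq_bigr => a _.
rewrite scaler_sumr -big_split /=; apply: eq_bigr => b _.
rewrite hpart_is_linear mulmxDr mulmxDl -scalemxAr -scalemxAl scalerBr scalerDr.
by rewrite opprD addrACA !scalerA [_ * c]mulrC.
Qed.

HB.instance Definition _ x :=
  GRing.isLinear.Build k 'M[k]_d 'M[k]_d *:%R (scomm x) (scomm_is_linear x).

End Operators.

(* Matrix of f (x) g for g homogeneous of parity b, where
   (f (x) g)(x (x) y) = (-1)^(b|x|) f(x) (x) g(y). *)
Definition stens d e (p : 'I_d -> bool) (b : bool)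
    (f : 'M[k]_d) (g : 'M[k]_e) : 'M[k]_(d * e) :=
  (f *m (if b then parity_mx p else 1%:M)) *t g.

(* The action of the generators E_i, F_i, h_i on a super vector space; the
   indices 1, 2 are ord0, ord_max : 'I_2. *)
Record uqdata := UqData {
  udim : nat;
  upar : 'I_udim -> bool;
  uE : 'I_2 -> 'M[k]_udim;
  uF : 'I_2 -> 'M[k]_udim;
  uh : 'I_2 -> 'M[k]_udim }.

Definition gpar (i : 'I_2) : bool := i == ord_max.

Section Modules.
Variable V : uqdata.
Local Notation d := (udim V).
Local Notation E := (uE V).
Local Notation F := (uF V).
Local Notation h := (uh V).
Local Notation P := (@upar V).

(* Stability under parity_mx says that U is a graded subspace. *)
Definition submodule (U : {vspace 'cV[k]_d}) : Prop :=
  [/\ forall v, v \in U -> parity_mx P *m v \in U,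
      forall i v, v \in U -> E i *m v \in U,
      forall i v, v \in U -> F i *m v \in U &
      forall i v, v \in U -> h i *m v \in U].

Definition generated_by (v : 'cV[k]_d) : Prop :=
  forall U : {vspace 'cV[k]_d}, submodule U -> v \in U -> U = fullv.

(* End_{U_q}(V): linear maps, of any parity, which supercommute with the
   action of the generators *)
Definition uq_End : {vspace 'M[k]_d} :=
  (\bigcap_(i < 2) (lker (linfun (scomm P (E i))) :&:
                    lker (linfun (scomm P (F i))) :&:
                    lker (linfun (scomm P (h i)))))%VS.

Lemma mem_uq_End (f : 'M[k]_d) :
  f \in uq_End <->
  forall i, [/\ scomm P (E i) f = 0, scomm P (F i) f = 0 &
                scomm P (h i) f = 0].
Proof.
rewrite /uq_End memvE; split=> [/subv_bigcapP fU i|fU].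
  have := fU i isT; rewrite -memvE !memv_cap !memv_ker !lfunE.
  by case/andP => /andP[/eqP ? /eqP ?] /eqP ?; split.
apply/subv_bigcapP => i _; rewrite -memvE !memv_cap !memv_ker !lfunE.
by have [/= -> -> ->] := fU i; rewrite eqxx.
Qed.

End Modules.

End SuperAlgebra.

Arguments submodule {k} V U.
Arguments generated_by {k} V v.
Arguments uq_End {k} V.

Section QuantumGroup.
Variable R : realType.
Let C := R[i].

(* C((hbar)), as the fraction field of C[[hbar]] *)
Definition laurent : fieldType := {fraction (fps C)}.
Local Notation k := laurent.

Definition cst (z : C) : k := @FracField.tofrac (fps C) (fpsC z).

(* q^z = exp (z hbar / 2) = \sum_n (z / 2)^n / n! hbar^n *)
Definition qpow (z : C) : k :=
  @FracField.tofrac (fps C) (fun n => (z / 2) ^+ n / n`!%:R).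
Definition q : k := qpow 1.

(* The operator q^h: it acts as q^z on the z-eigenspace of h for z in C. This
   determines q^h as soon as h is diagonalizable with eigenvalues in C, which
   is part of the definition of a module below. *)
Definition qexp d (h : 'M[k]_d) : 'M[k]_d :=
  xget 0 [set K : 'M[k]_d | forall (z : C) (v : 'cV[k]_d),
            h *m v = cst z *: v -> K *m v = qpow z *: v].

Definition cartan (i j : 'I_2) : int :=
  if i != j then -1 else if i == ord0 then 2 else 0.

Definition serre d (x y : 'M[k]_d) : 'M[k]_d :=
  x *m x *m y - (q + q^-1) *: (x *m y *m x) + y *m x *m x.

Section Modules.
Variable V : uqdata k.
Local Notation d := (udim V).
Local Notation E := (uE V).
Local Notation F := (uF V).
Local Notation h := (uh V).
Local Notation P := (@upar _ V).
Local Notation "[ x , y ]" := (scomm P x y).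

Definition weight_vector (a1 a2 : C) (v : 'cV[k]_d) : Prop :=
  h ord0 *m v = cst a1 *: v /\ h ord_max *m v = cst a2 *: v.

(* there is a basis (the columns of B) of weight vectors *)
Definition weight_module : Prop :=
  exists2 B : 'M[k]_d, B \in unitmx &
    forall j, exists a1 a2 : C, weight_vector a1 a2 (col j B).

Record uq_module : Prop := UqModule {
  uE_par : forall i, homogeneous P (gpar i) (E i);
  uF_par : forall i, homogeneous P (gpar i) (F i);
  uh_par : forall i, homogeneous P false (h i);
  uh_diag : weight_module;
  uhh : forall i j, [h i, h j] = 0;
  uhE : forall i j, [h i, E j] = (cartan i j)%:~R *: E j;
  uhF : forall i j, [h i, F j] = - (cartan i j)%:~R *: F j;
  uEF : forall i j, [E i, F j] =
    if i == j then (q - q^-1)^-1 *: (qexp (h i) - qexp (- h i)) else 0;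
  uEE : E ord_max *m E ord_max = 0;
  uFF : F ord_max *m F ord_max = 0;
  uE_serre : serre (E ord0) (E ord_max) = 0;
  uF_serre : serre (F ord0) (F ord_max) = 0 }.

Definition simple_module : Prop :=
  [/\ uq_module, (0 < d)%N &
      forall U : {vspace 'cV[k]_d}, submodule V U -> U = 0%VS \/ U = fullv].

Definition highest_weight_vector (a1 a2 : C) (v : 'cV[k]_d) : Prop :=
  [/\ v != 0, weight_vector a1 a2 v & forall i, E i *m v = 0].

(* V is a realization of V(a1, a2), which is unique up to isomorphism and
   parity shift *)
Definition is_Vmod (a1 : nat) (a2 : C) : Prop :=
  simple_module /\
  exists2 v, highest_weight_vector a1%:R a2 v & generated_by V v.

End Modules.

Definition uq_tens (V W : uqdata k) : uqdata k :=
  let st := @stens k _ (udim W) (@upar _ V) in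
  @UqData k (udim V * udim W)
    (fun l => upar (mxtens_unindex l).1 (+) upar (mxtens_unindex l).2)
    (fun i => st false (uE V i) 1%:M
              + st (gpar i) (qexp (- uh V i)) (uE W i))
    (fun i => st false (uF V i) (qexp (uh W i))
              + st (gpar i) 1%:M (uF W i))
    (fun i => st false (uh V i) 1%:M + st false 1%:M (uh W i)).

Definition uq_triv : uqdata k :=
  @UqData k 1 (fun=> false) (fun=> 0) (fun=> 0) (fun=> 0).

Fixpoint uq_tpow (V : uqdata k) (n : nat) : uqdata k :=
  match n with
  | 0 => uq_triv
  | 1 => V
  | n'.+1 => uq_tens (uq_tpow V n') V
  end.

(* This is LG_n(alpha) when V is a realization of V(0, alpha). *)
Definition LG (V : uqdata k) (n : nat) : {vspace 'M[k]_(udim (uq_tpow V n))} :=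
  uq_End (uq_tpow V n).

End QuantumGroup.

(* Main.v *)
(* Write X = V^(x)n, W = X (x) V and let v3 be the lowest vector of V = V(0, alpha).
   The products T+ = E2 E1 E2 and T- = F2 F1 F2 commute with E1 and F1, so
   iota : x |-> T+ (x (x) v3) embeds X into W as a module over the even part
   U_q(gl(2)), with image killed by E2. Typicality (alpha irrational) makes
   T+ T- invertible on that image, hence W is the direct sum of iota X,
   F2 iota X, F1 F2 iota X and T- iota X: it is induced from X, and
   End_{U_q(sl(2|1))} W is isomorphic to End_{U_q(gl(2))} X.
   On End X, the adjoint action of E1 maps degree 0 onto degree 2 - and its
   degree 0 kernel is killed by F1 as well - so the dimension is the number of
   pairs of equal weights of X minus the number of pairs of weights differing
   by the root of E1. The weights of V are those of the exterior algebra of a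
   plane, which gives binom(2n,n)^2 - binom(2n,n+1)^2. *)

Require Import Defs.
From HB Require Import structures.
From mathcomp Require Import all_boot all_order all_algebra.
From mathcomp Require Import boolp classical_sets reals complex mxtens.
From mathcomp Require Import ring zify.

Set Implicit Arguments.
Unset Strict Implicit.
Unset Printing Implicit Defensive.

Import Order.TTheory GRing.Theory Num.Theory.
Local Open Scope ring_scope.

(** * Matrix preliminaries *)

(** In a tensor power of V the parity of a weight vector is, up to a global sign, the parity of its
    h1-weight. A map commuting with h1 and h2 is therefore even, and supercommutation with the
    generators becomes ordinary commutation. This permits working with plain matrices in weight
    bases: a weight is a pair of integers plus an offset of h2 recorded as q^z, and the link with
    the abstract modules is a change of basis.

    The vector v3 is chosen because it spans a trivial module of U_q(sl(2)) while T+ still carries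
    it back to v0; the v0-component of iota is an invertible diagonal matrix, whence injectivity.
    Since dim V = 4, four independent copies of X fill W by dimension. An endomorphism of W commutes
    with T+, whose image is exactly iota X, so it restricts to X and is determined by that
    restriction.

    Typicality amounts to [h2] and [h1 + h2 + 1] having no zero on iota X. There h2 takes values in
    (n+1) alpha + Z, which is why alpha must avoid all rationals when n is arbitrary.

    Complete reducibility for U_q(sl(2)) is replaced by two explicit recursions on nilpotent
    operators, using only that q is not a root of unity. *)

Section MatrixEntries.
Variable k : pzRingType.

Lemma addmxE m n (A B : 'M[k]_(m, n)) i j : (A + B) i j = A i j + B i j.
Proof. by rewrite mxE. Qed.

Lemma oppmxE m n (A : 'M[k]_(m, n)) i j : (- A) i j = - A i j.
Proof. by rewrite mxE. Qed.

Lemma scalemxE m n c (A : 'M[k]_(m, n)) i j : (c *: A) i j = c * A i j.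
Proof. by rewrite mxE. Qed.

Lemma zeromxE m n i j : (0 : 'M[k]_(m, n)) i j = 0.
Proof. by rewrite mxE. Qed.

End MatrixEntries.

(* Decides identities between linear combinations of matrices, the matrix
   products being atoms. *)
Ltac mxlin :=
  apply/matrixP => ? ?;
  rewrite ?(addmxE, oppmxE, scalemxE, zeromxE); try ring; field.

Section TensorLinearity.
Variables (k : comPzRingType) (m n p r : nat).
Implicit Types (A : 'M[k]_(m, n)) (B : 'M[k]_(p, r)).

Lemma tensmxDl A A' B : (A + A') *t B = A *t B + A' *t B.
Proof. by apply/matrixP => i j; rewrite !mxE mulrDl. Qed.

Lemma tensmxDr A B B' : A *t (B + B') = A *t B + A *t B'.
Proof. by apply/matrixP => i j; rewrite !mxE mulrDr. Qed.

Lemma tensmxNl A B : (- A) *t B = - (A *t B).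
Proof. by apply/matrixP => i j; rewrite !mxE mulNr. Qed.

Lemma tensmxNr A B : A *t (- B) = - (A *t B).
Proof. by apply/matrixP => i j; rewrite !mxE mulrN. Qed.

Lemma tensmxZl c A B : (c *: A) *t B = c *: (A *t B).
Proof. by apply/matrixP => i j; rewrite !mxE mulrA. Qed.

Lemma tensmxZr c A B : A *t (c *: B) = c *: (A *t B).
Proof. by apply/matrixP => i j; rewrite !mxE mulrCA. Qed.

End TensorLinearity.

Lemma tensmx11 (k : comPzRingType) m n :
  (1%:M : 'M[k]_m) *t (1%:M : 'M[k]_n) = 1%:M.
Proof.
apply/matrixP => i j.
case: (mxtens_indexP i) => i0 i1; case: (mxtens_indexP j) => j0 j1.
rewrite tensmxE !mxE (can_eq (@mxtens_indexK _ _)) xpair_eqE.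
by case: eqP; case: eqP => //= _ _; rewrite ?mulr1 ?mulr0 ?mul0r.
Qed.

Definition qserre (k : fieldType) (q : k) d (x y : 'M[k]_d) : 'M[k]_d :=
  x *m x *m y - (q + q^-1) *: (x *m y *m x) + y *m x *m x.

(** Besides the two given Serre expressions, only mixed terms appear. Once the q-commutations put
    them in a fixed order, every monomial gets a vanishing coefficient, such as 1 - (q + q^-1) q +
    q^2. *)
Lemma qserreD (k : fieldType) (q : k) d (a a' b b' : 'M[k]_d) : q != 0 ->
  qserre q a b = 0 -> qserre q a' b' = 0 ->
  a' *m a = q^-2 *: (a *m a') -> a' *m b = q *: (b *m a') ->
  b' *m a = q *: (a *m b') -> qserre q (a + a') (b + b') = 0.
Proof.
move=> q0 s1 s2 aa ab ba.
have -> : qserre q (a + a') (b + b') = qserre q a b + qserre q a' b' +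
  (a *m a *m b' - (q + q^-1) *: (a *m (b' *m a)) + b' *m a *m a) +
  (a *m (a' *m b) + a' *m a *m b - (q + q^-1) *: (a *m b *m a' + a' *m b *m a)
    + b *m a *m a' + b *m (a' *m a)) +
  (a' *m a' *m b - (q + q^-1) *: (a' *m b *m a') + b *m a' *m a') +
  (a *m a' *m b' + a' *m a *m b' - (q + q^-1) *: (a *m b' *m a' + a' *m (b' *m a))
    + b' *m a *m a' + b' *m (a' *m a)).
  rewrite /qserre !(mulmxDl, mulmxDr) !mulmxA; mxlin.
have aa3 (x : 'M_d) : x *m a' *m a = q^-2 *: (x *m a *m a').
  by rewrite -mulmxA aa -scalemxAr mulmxA.
have ab3 (x : 'M_d) : x *m a' *m b = q *: (x *m b *m a').
  by rewrite -mulmxA ab -scalemxAr mulmxA.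
have ba3 (x : 'M_d) : x *m b' *m a = q *: (x *m a *m b').
  by rewrite -mulmxA ba -scalemxAr mulmxA.
rewrite s1 s2 !mulmxA !(aa3, ab3, ba3, aa, ab, ba, =^~ scalemxAr, =^~ scalemxAl, scalerA).
mxlin; exact: q0.
Qed.

(** * Graded modules in weight bases *)

Definition wt : Type := int * int.

Section Degree.
Variable k : fieldType.

Definition has_deg a b (u : 'I_a -> wt) (v : 'I_b -> wt) (m : wt)
    (A : 'M[k]_(a, b)) : Prop :=
  forall i j, A i j != 0 -> u i = v j + m.

Definition wdiag d (w : 'I_d -> wt) (g : wt -> k) : 'M[k]_d :=
  diag_mx (\row_j g (w j)).

Lemma has_degD a b u v m (A B : 'M[k]_(a, b)) :
  has_deg u v m A -> has_deg u v m B -> has_deg u v m (A + B).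
Proof.
move=> dA dB i j; rewrite mxE; have [Aij|/dA //] := eqVneq (A i j) 0.
by rewrite Aij add0r; apply: dB.
Qed.

Lemma has_degN a b u v m (A : 'M[k]_(a, b)) :
  has_deg u v m A -> has_deg u v m (- A).
Proof. by move=> dA i j; rewrite mxE oppr_eq0; apply: dA. Qed.

Lemma has_degB a b u v m (A B : 'M[k]_(a, b)) :
  has_deg u v m A -> has_deg u v m B -> has_deg u v m (A - B).
Proof. by move=> dA dB; apply/has_degD/has_degN. Qed.

Lemma has_degM a b c u v w m n (A : 'M[k]_(a, b)) (B : 'M[k]_(b, c)) :
  has_deg u v m A -> has_deg v w n B -> has_deg u w (n + m) (A *m B).
Proof.
move=> dA dB i j; rewrite mxE => /eqP nz.
have [l] : exists l, A i l * B l j != 0.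
  apply/existsP; apply: contra_notT nz => /existsPn nz.
  by apply: big1 => l _; apply/eqP; rewrite -[_ == _]negbK nz.
by rewrite mulf_eq0 negb_or => /andP[/dA -> /dB ->]; rewrite addrA.
Qed.

Lemma has_deg_wdiag d (w : 'I_d -> wt) g : has_deg w w 0 (wdiag w g).
Proof.
move=> i j; rewrite !mxE addr0; case: (i =P j) => [-> //|_].
by rewrite mulr0n eqxx.
Qed.

Lemma eq_wdiag d (w : 'I_d -> wt) g g' :
  (forall z, g z = g' z) -> wdiag w g = wdiag w g'.
Proof. by move=> e; congr diag_mx; apply/rowP => j; rewrite !mxE e. Qed.

Lemma wdiagM d (w : 'I_d -> wt) g g' :
  wdiag w g *m wdiag w g' = wdiag w (fun z => g z * g' z).
Proof. by rewrite mulmx_diag; congr diag_mx; apply/rowP => j; rewrite !mxE. Qed.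

Lemma wdiagB d (w : 'I_d -> wt) g g' :
  wdiag w g - wdiag w g' = wdiag w (fun z => g z - g' z).
Proof. by rewrite /wdiag -raddfB; congr diag_mx; apply/rowP => j; rewrite !mxE. Qed.

Lemma wdiag_const d (w : 'I_d -> wt) c : wdiag w (fun=> c) = c%:M.
Proof. by rewrite -diag_const_mx; congr diag_mx; apply/rowP => j; rewrite !mxE. Qed.

Lemma wdiag1 d (w : 'I_d -> wt) : wdiag w (fun=> 1) = 1%:M.
Proof. exact: wdiag_const. Qed.

Lemma wdiag_deg a b u v m (A : 'M[k]_(a, b)) g : has_deg u v m A ->
  wdiag u g *m A = A *m wdiag v (fun z => g (z + m)).
Proof.
move=> dA; apply/matrixP => i j; rewrite mul_diag_mx mul_mx_diag !mxE mulrC.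
by have [->|/dA ->] := eqVneq (A i j) 0; rewrite ?mul0r.
Qed.

Lemma wdiag_degZ a b u v m (A : 'M[k]_(a, b)) g c : has_deg u v m A ->
  (forall z, g (z + m) = c * g z) ->
  wdiag u g *m A = c *: (A *m wdiag v g).
Proof.
move=> dA gm; rewrite (wdiag_deg _ dA) scalemxAr; congr (_ *m _).
by apply/matrixP => i j; rewrite !mxE gm mulrnAr.
Qed.

Definition twt a b (u : 'I_a -> wt) (v : 'I_b -> wt) (l : 'I_(a * b)) : wt :=
  u (mxtens_unindex l).1 + v (mxtens_unindex l).2.

Lemma has_deg_tens a b a' b' u v u' v' m m'
    (A : 'M[k]_(a, b)) (B : 'M[k]_(a', b')) :
  has_deg u v m A -> has_deg u' v' m' B ->
  has_deg (twt u u') (twt v v') (m + m') (A *t B).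
Proof.
move=> dA dB i j; rewrite mxE mulf_eq0 negb_or => /andP[/dA e /dB e'].
by rewrite /twt e e' addrACA.
Qed.

Lemma wdiag_tens a b (u : 'I_a -> wt) (v : 'I_b -> wt) g g' g'' :
  (forall z z', g z * g' z' = g'' (z + z')) ->
  wdiag u g *t wdiag v g' = wdiag (twt u v) g''.
Proof.
move=> gD; apply/matrixP => i j.
case: (mxtens_indexP i) => i0 i1; case: (mxtens_indexP j) => j0 j1.
rewrite tensmxE !mxE (can_eq (@mxtens_indexK _ _)) xpair_eqE /twt.
rewrite mxtens_indexK -gD.
by case: eqP; case: eqP => //= _ _; rewrite ?(mulr0n, mulr1n, mulr0, mul0r).
Qed.

End Degree.

Section GradedModules.
Variables (k : fieldType) (q : k).

Definition qbr (x : k) : k := (x - x^-1) / (q - q^-1).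

(* Matrices of the generators in a basis of weight vectors: the j-th basis
   vector has weight gwt j + (0, z) where q^z = gc, and parity operator
   gs * (-1)^(gwt j).1. *)
Record gmod := GMod {
  gdim : nat;
  gwt : 'I_gdim -> wt;
  gc : k;
  gs : k;
  gE1 : 'M[k]_gdim;
  gE2 : 'M[k]_gdim;
  gF1 : 'M[k]_gdim;
  gF2 : 'M[k]_gdim }.

Definition gdiag (M : gmod) : (wt -> k) -> 'M[k]_(gdim M) :=
  wdiag (@gwt M).
Definition gK1 M := gdiag M (fun z => q ^ z.1).
Definition gL1 M := gdiag M (fun z => q ^ (- z.1)).
Definition gK2 M := gdiag M (fun z => gc M * q ^ z.2).
Definition gL2 M := gdiag M (fun z => (gc M)^-1 * q ^ (- z.2)).
(** Only E2 and F2 change the first weight coordinate by an odd number, so parity can be read off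
    that coordinate up to the sign [gs]. *)
Definition gP M := gdiag M (fun z => gs M * (-1) ^ z.1).

Definition gdeg (M : gmod) : wt -> 'M[k]_(gdim M) -> Prop :=
  has_deg (@gwt M) (@gwt M).

Record rels (M : gmod) : Prop := Rels {
  c_neq0 : gc M != 0;
  s_sqr : gs M * gs M = 1;
  degE1 : gdeg (2, -1) (gE1 M);
  degE2 : gdeg (-1, 0) (gE2 M);
  degF1 : gdeg (-2, 1) (gF1 M);
  degF2 : gdeg (1, 0) (gF2 M);
  EF11 : gE1 M *m gF1 M - gF1 M *m gE1 M = gdiag M (fun z => qbr (q ^ z.1));
  EF22 : gE2 M *m gF2 M + gF2 M *m gE2 M =
         gdiag M (fun z => qbr (gc M * q ^ z.2));
  EF12 : gE1 M *m gF2 M = gF2 M *m gE1 M;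
  EF21 : gE2 M *m gF1 M = gF1 M *m gE2 M;
  EE22 : gE2 M *m gE2 M = 0;
  FF22 : gF2 M *m gF2 M = 0;
  serreE : qserre q (gE1 M) (gE2 M) = 0;
  serreF : qserre q (gF1 M) (gF2 M) = 0 }.

Definition gtens (M N : gmod) : gmod :=
  @GMod (gdim M * gdim N) (twt (@gwt M) (@gwt N)) (gc M * gc N) (gs M * gs N)
    (gE1 M *t 1%:M + gL1 M *t gE1 N)
    (gE2 M *t 1%:M + (gL2 M *m gP M) *t gE2 N)
    (gF1 M *t gK1 N + 1%:M *t gF1 N)
    (gF2 M *t gK2 N + gP M *t gF2 N).

Hypothesis q_neq0 : q != 0.

Lemma gP_tens M N : gP (gtens M N) = gP M *t gP N.
Proof.
by symmetry; apply: wdiag_tens => z z'; rewrite mulrACA -expfzDr ?oppr_eq0 ?oner_eq0.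
Qed.

Section OneModule.
Variables (M : gmod) (rM : rels M).
Local Notation E1 := (gE1 M). Local Notation E2 := (gE2 M).
Local Notation F1 := (gF1 M). Local Notation F2 := (gF2 M).
Local Notation K1 := (gK1 M). Local Notation K2 := (gK2 M).
Local Notation L1 := (gL1 M). Local Notation L2 := (gL2 M).
Local Notation P := (gP M).

Section Shift.
Variables (a b : int) (A : 'M[k]_(gdim M)) (dA : gdeg (a, b) A).

Lemma K1_deg : K1 *m A = q ^ a *: (A *m K1).
Proof. by apply: wdiag_degZ dA _ => z; rewrite expfzDr // mulrC. Qed.
Lemma L1_deg : L1 *m A = q ^ (- a) *: (A *m L1).
Proof. by apply: wdiag_degZ dA _ => z; rewrite opprD expfzDr // mulrC. Qed.
Lemma K2_deg : K2 *m A = q ^ b *: (A *m K2).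
Proof. by apply: wdiag_degZ dA _ => z; rewrite expfzDr // [in RHS]mulrC mulrA. Qed.
Lemma L2_deg : L2 *m A = q ^ (- b) *: (A *m L2).
Proof.
by apply: wdiag_degZ dA _ => z; rewrite opprD expfzDr // [in RHS]mulrC mulrA.
Qed.
Lemma P_deg : P *m A = (-1) ^ a *: (A *m P).
Proof.
apply: wdiag_degZ dA _ => z.
by rewrite expfzDr ?oppr_eq0 ?oner_eq0 // [in RHS]mulrC mulrA.
Qed.
End Shift.

Lemma K1L1 : K1 *m L1 = 1%:M.
Proof.
rewrite wdiagM -(wdiag1 k (@gwt M)); apply: eq_wdiag => z.
by rewrite -expfzDr // subrr.
Qed.
Lemma K2L2 : K2 *m L2 = 1%:M.
Proof.
rewrite wdiagM -(wdiag1 k (@gwt M)); apply: eq_wdiag => z.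
by rewrite mulrACA divff ?c_neq0 // mul1r -expfzDr // subrr.
Qed.
Lemma PP : P *m P = 1%:M.
Proof.
rewrite wdiagM -(wdiag1 k (@gwt M)); apply: eq_wdiag => z.
by rewrite mulrACA s_sqr // mul1r -expfzMl mulrNN mulr1 exp1rz.
Qed.

End OneModule.

End GradedModules.

(** * Compatibility of the relations with the coproduct *)

Section TensorRelations.
Variables (k : fieldType) (q : k) (q_neq0 : q != 0).
Variables (M N : gmod k) (rM : rels q M) (rN : rels q N).

Lemma qserre_tensl d d' (a : 'M[k]_d') b (c e : 'M[k]_d) :
  c *m e = e *m c -> qserre q a b = 0 -> qserre q (a *t c) (b *t e) = 0.
Proof.
move=> ce s; rewrite /qserre !tensmx_mul.
have -> : c *m e *m c = c *m c *m e by rewrite -mulmxA -ce mulmxA.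
have -> : e *m c *m c = c *m c *m e by rewrite -ce -mulmxA -ce mulmxA.
by rewrite -tensmxZl -tensmxNl -!tensmxDl -/(qserre q a b) s tens0mx.
Qed.

Lemma qserre_tensr d d' (a : 'M[k]_d') b (c e : 'M[k]_d) :
  c *m e = e *m c -> qserre q a b = 0 -> qserre q (c *t a) (e *t b) = 0.
Proof.
move=> ce s; rewrite /qserre !tensmx_mul.
have -> : c *m e *m c = c *m c *m e by rewrite -mulmxA -ce mulmxA.
have -> : e *m c *m c = c *m c *m e by rewrite -ce -mulmxA -ce mulmxA.
by rewrite -tensmxZr -tensmxNr -!tensmxDr -/(qserre q a b) s tensmx0.
Qed.

Lemma gdiagC (L : gmod k) g g' : gdiag L g *m gdiag L g' = gdiag L g' *m gdiag L g.
Proof. by rewrite !wdiagM; apply: eq_wdiag => z; rewrite mulrC. Qed.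

Lemma gdeg_tens (m : wt) A B C D a b c e :
  gdeg (M := M) a A -> gdeg (M := N) b B -> gdeg (M := M) c C ->
  gdeg (M := N) e D -> a + b = m -> c + e = m ->
  gdeg (M := gtens q M N) m (A *t B + C *t D).
Proof.
move=> dA dB dC dD <- ce; apply: has_degD; first exact: has_deg_tens.
by rewrite -ce; exact: has_deg_tens.
Qed.

Lemma gdeg1 (L : gmod k) : gdeg (M := L) 0 1%:M.
Proof. by rewrite -(wdiag1 k (@gwt _ L)); apply: has_deg_wdiag. Qed.

Lemma gdeg_gdiag (L : gmod k) g : gdeg (M := L) 0 (gdiag L g).
Proof. exact: has_deg_wdiag. Qed.

Lemma gdegLP (L : gmod k) : gdeg (M := L) 0 (gL2 q L *m gP L).
Proof. by rewrite [gL2 _ _ *m _]wdiagM; exact: has_deg_wdiag. Qed.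

Lemma LP_deg (L : gmod k) (rL : rels q L) a b (A : 'M[k]_(gdim L)) :
  gdeg (M := L) (a, b) A ->
  gL2 q L *m gP L *m A = ((-1) ^ a * q ^ (- b)) *: (A *m (gL2 q L *m gP L)).
Proof.
move=> dA; rewrite -mulmxA (P_deg dA) -scalemxAr [gL2 q L *m (A *m _)]mulmxA (L2_deg q_neq0 dA).
by rewrite -scalemxAl scalerA mulmxA.
Qed.

Lemma wdiag_tensD a b (u : 'I_a -> wt) (v : 'I_b -> wt) (g1 g2 g3 g4 : wt -> k) g :
  (forall z z', g1 z * g2 z' + g3 z * g4 z' = g (z + z')) ->
  wdiag u g1 *t wdiag v g2 + wdiag u g3 *t wdiag v g4 = wdiag (twt u v) g.
Proof.
move=> gD; apply/matrixP => i j.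
case: (mxtens_indexP i) => i0 i1; case: (mxtens_indexP j) => j0 j1.
rewrite mxE !tensmxE !mxE (can_eq (@mxtens_indexK _ _)) xpair_eqE /twt.
rewrite mxtens_indexK -gD.
by case: eqP; case: eqP => //= _ _;
  rewrite ?(mulr0n, mulr1n, mulr0, mul0r, addr0).
Qed.

Let eM1 := degE1 rM. Let eM2 := degE2 rM. Let fM1 := degF1 rM. Let fM2 := degF2 rM.
Let eN1 := degE1 rN. Let eN2 := degE2 rN. Let fN1 := degF1 rN. Let fN2 := degF2 rN.

Let expand := (mulmxDl, mulmxDr, tensmx_mul, mul1mx, mulmx1).
Let scal := (@tensmxZl, @tensmxZr, =^~ scalemxAl, =^~ scalemxAr, scalerA).

Lemma rels_gtens : rels q (gtens q M N).
Proof.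
split.
- by rewrite mulf_neq0 ?(c_neq0 rM) ?(c_neq0 rN).
- by rewrite mulrACA (s_sqr rM) (s_sqr rN) mulr1.
- exact: (gdeg_tens eM1 (@gdeg1 N) (@gdeg_gdiag M _) eN1 erefl erefl).
- exact: (gdeg_tens eM2 (@gdeg1 N) (@gdegLP M) eN2 erefl erefl).
- exact: (gdeg_tens fM1 (@gdeg_gdiag N _) (@gdeg1 M) fN1 erefl erefl).
- exact: (gdeg_tens fM2 (@gdeg_gdiag N _) (@gdeg_gdiag M _) fN2 erefl erefl).
- have LF : gL1 q M *m gF1 M = q ^+ 2 *: (gF1 M *m gL1 q M) := L1_deg q_neq0 fM1.
  have KE : gK1 q N *m gE1 N = q ^+ 2 *: (gE1 N *m gK1 q N) := K1_deg q_neq0 eN1.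
  (* The two cross terms in F1 and E1 carry the same factor q^2 and cancel. What remains is the
     addition rule [x + y] = [x] q^y + q^-x [y]. *)
  transitivity ((gE1 M *m gF1 M - gF1 M *m gE1 M) *t gK1 q N +
    gL1 q M *t (gE1 N *m gF1 N - gF1 N *m gE1 N)).
    by rewrite /= !expand LF KE !scal !(tensmxDl, tensmxDr, tensmxNl, tensmxNr); mxlin.
  rewrite (EF11 rM) (EF11 rN); apply: wdiag_tensD => z z' /=.
  by rewrite expfzDr // /qbr invfM !invr_expz; ring.
- have LF : gL2 q M *m gP M *m gF2 M = - (gF2 M *m (gL2 q M *m gP M)).
    by rewrite (LP_deg rM fM2) mulr1 scaleN1r.
  have KE : gK2 q N *m gE2 N = gE2 N *m gK2 q N.
    by rewrite (K2_deg q_neq0 eN2) scale1r.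
  have PE : gP M *m gE2 M = - (gE2 M *m gP M).
    by rewrite (P_deg eM2) exprN1 invrN1 scaleN1r.
  have LPP : gL2 q M *m gP M *m gP M = gL2 q M by rewrite -mulmxA (PP rM) mulmx1.
  have PLP : gP M *m (gL2 q M *m gP M) = gL2 q M by rewrite mulmxA (@gdiagC M) LPP.
  transitivity ((gE2 M *m gF2 M + gF2 M *m gE2 M) *t gK2 q N +
    gL2 q M *t (gE2 N *m gF2 N + gF2 N *m gE2 N)).
    rewrite /= !expand LF KE PE LPP PLP !(tensmxDl, tensmxDr, tensmxNl, tensmxNr).
    mxlin.
  rewrite (EF22 rM) (EF22 rN); apply: wdiag_tensD => z z' /=.
  by rewrite expfzDr // /qbr !invfM !invr_expz; ring.
- have LF : gL1 q M *m gF2 M = q^-1 *: (gF2 M *m gL1 q M) := L1_deg q_neq0 fM2.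
  have KE : gK2 q N *m gE1 N = q^-1 *: (gE1 N *m gK2 q N) := K2_deg q_neq0 eN1.
  have PE : gP M *m gE1 M = gE1 M *m gP M 
    by rewrite (P_deg eM1) (etrans (sqrrN 1) (expr1n _ _) : (-1) ^ 2 = 1 :> k) scale1r.
  rewrite /= !expand LF KE PE !scal.
  by rewrite (EF12 rM) (EF12 rN) [gP M *m _](@gdiagC M); mxlin.
- have LF : gL2 q M *m gP M *m gF1 M = q^-1 *: (gF1 M *m (gL2 q M *m gP M)).
    by rewrite (LP_deg rM fM1) /= /exprz /= expr2 mulrNN mulr1 invr1 mul1r.
  have KE : gK1 q N *m gE2 N = q^-1 *: (gE2 N *m gK1 q N) := K1_deg q_neq0 eN2.
  by rewrite /= !expand LF KE !scal (EF21 rM) (EF21 rN); mxlin.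
- have LE : gL2 q M *m gP M *m gE2 M = - (gE2 M *m (gL2 q M *m gP M)).
    by rewrite (LP_deg rM eM2) mulr1 exprN1 invrN1 scaleN1r.
  rewrite /= !expand LE (EE22 rM) (EE22 rN) tensmxNl tens0mx tensmx0; mxlin.
- have PF : gP M *m gF2 M = - (gF2 M *m gP M) by rewrite (P_deg fM2) scaleN1r.
  have KF : gK2 q N *m gF2 N = gF2 N *m gK2 q N.
    by rewrite (K2_deg q_neq0 fN2) scale1r.
  rewrite /= !expand PF KF (FF22 rM) (FF22 rN) tensmxNl tens0mx tensmx0; mxlin.
- apply: qserreD => //=.
  + exact: qserre_tensl (serreE rM).
  + apply: qserre_tensr (serreE rN).
    by rewrite [gL2 q M *m _]wdiagM; exact: gdiagC.
  + by rewrite !expand (L1_deg q_neq0 eM1) !scal.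
  + by rewrite !expand (L1_deg q_neq0 eM2) !scal.
  + rewrite !expand (LP_deg rM eM1) (etrans (sqrrN 1) (expr1n _ _) : (-1) ^ 2 = 1 :> k).
    by rewrite mul1r !scal.
(* The summands of each F are swapped because the factor q^-2 in [qserreD] now comes from moving K1
   of the second factor past F1 of that factor. *)
- rewrite /= [_ + 1%:M *t _]addrC [_ + gP M *t _]addrC.
  apply: qserreD => //=.
  + by apply: qserre_tensr (serreF rN); rewrite mul1mx mulmx1.
  + by apply: qserre_tensl (serreF rM); rewrite gdiagC.
  + by rewrite !expand (K1_deg q_neq0 fN1) !scal.
  + have PF : gP M *m gF1 M = gF1 M *m gP M.
      by rewrite (P_deg fM1) /= /exprz /= sqrrN expr1n invr1 scale1r.
    by rewrite !expand (K1_deg q_neq0 fN2) PF !scal.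
  + by rewrite !expand (K2_deg q_neq0 fN1) !scal.
Qed.

End TensorRelations.

(** * The standard module and its tensor powers *)

Section Blocks.
Variables (k : fieldType) (d e : nat).

(** The map x |-> x (x) e_m, with e_m the m-th basis vector of the second factor; its transpose
    reads off the component along e_m. *)
Definition inj_mx (m : 'I_e) : 'M[k]_(d * e, d) :=
  \matrix_(l, j) (mxtens_unindex l == (j, m))%:R.
Definition prj_mx (m : 'I_e) : 'M[k]_(d, d * e) := (inj_mx m)^T.

Lemma prj_inj m m' : prj_mx m *m inj_mx m' = (m == m')%:R *: 1%:M.
Proof.
apply/matrixP => i j; rewrite !mxE (bigD1 (mxtens_index (i, m))) //=.
rewrite big1 => [|l ne]; rewrite !mxE ?mxtens_indexK ?eqxx ?mul1r ?addr0.
  by rewrite xpair_eqE -natrM mulnb andbC.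
have [e1|_] := eqVneq (mxtens_unindex l) (i, m); last by rewrite mul0r.
by rewrite -e1 mxtens_unindexK eqxx in ne.
Qed.

Lemma mul_inj_mx n (A : 'M[k]_(d, n)) m i i' j :
  (inj_mx m *m A) (mxtens_index (i, i')) j = (i' == m)%:R * A i j.
Proof.
rewrite mxE (bigD1 i) //= mxE mxtens_indexK xpair_eqE eqxx big1 ?addr0 // => l ne.
by rewrite mxE mxtens_indexK xpair_eqE eq_sym (negPf ne) mul0r.
Qed.

Lemma mul_mx_prj n (A : 'M[k]_(n, d)) m i j j' :
  (A *m prj_mx m) i (mxtens_index (j, j')) = (j' == m)%:R * A i j.
Proof.
have -> : A *m prj_mx m = (inj_mx m *m A^T)^T by rewrite trmx_mul trmxK.
by rewrite mxE mul_inj_mx mxE.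
Qed.

Lemma mul_mx_inj n (A : 'M[k]_(n, d * e)) m i j :
  (A *m inj_mx m) i j = A i (mxtens_index (j, m)).
Proof.
rewrite mxE (bigD1 (mxtens_index (j, m))) //= mxE mxtens_indexK eqxx mulr1.
rewrite big1 ?addr0 // => l ne; rewrite mxE.
have [e1|_] := eqVneq (mxtens_unindex l) (j, m); last by rewrite mulr0.
by rewrite -e1 mxtens_unindexK eqxx in ne.
Qed.

Lemma tens_inj (A : 'M[k]_d) (B : 'M[k]_e) m :
  (A *t B) *m inj_mx m = \sum_m' B m' m *: (inj_mx m' *m A).
Proof.
apply/matrixP => i j; case: (mxtens_indexP i) => i0 i1.
rewrite mul_mx_inj tensmxE summxE (bigD1 i1) //= scalemxE mul_inj_mx eqxx mul1r.
rewrite big1 ?addr0; first by rewrite mulrC.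
by move=> l ne; rewrite scalemxE mul_inj_mx eq_sym (negPf ne) mul0r mulr0.
Qed.

Lemma prj_tens (A : 'M[k]_d) (B : 'M[k]_e) m :
  prj_mx m *m (A *t B) = \sum_m' B m m' *: (A *m prj_mx m').
Proof.
apply: trmx_inj; rewrite trmx_mul trmxK trmx_tens tens_inj raddf_sum /=.
by apply: eq_bigr => m' _; rewrite linearZ /= trmx_mul trmxK mxE.
Qed.

Lemma tens_mx1 (A : 'M[k]_d) :
  A *t (1%:M : 'M_e) = \sum_m inj_mx m *m A *m prj_mx m.
Proof.
apply/matrixP => i j; case: (mxtens_indexP i) => i0 i1; case: (mxtens_indexP j) => j0 j1.
rewrite tensmxE summxE (bigD1 j1) //= mul_mx_prj mul_inj_mx eqxx mul1r mulrC.
rewrite mxE big1 ?addr0 // => l ne.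
by rewrite mul_mx_prj eq_sym (negPf ne) mul0r.
Qed.

Lemma sum_inj_prj : \sum_m inj_mx m *m prj_mx m = 1%:M.
Proof.
by rewrite -tensmx11 tens_mx1; apply: eq_bigr => m _; rewrite mulmx1.
Qed.

Lemma has_deg_inj (u : 'I_d -> wt) (v : 'I_e -> wt) m :
  has_deg (twt u v) u (v m) (inj_mx m).
Proof.
move=> i j; rewrite mxE /twt; have [-> //|_] := eqVneq (mxtens_unindex i) (j, m).
by rewrite eqxx.
Qed.

End Blocks.

Definition gtriv (k : fieldType) : gmod k :=
  @GMod k 1 (fun=> 0) 1 1 0 0 0 0.

(* The basis v, F2 v, F1 F2 v, F2 F1 F2 v of V(0, a), with kap = q^a. *)
Definition gstd (k : fieldType) (q kap s : k) : gmod k :=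
  let d (i j : 'I_4) a b : bool := (val i == a) && (val j == b) in
  @GMod k 4 (fun j => nth 0 [:: (0, 0); (1, 0); (-1, 1); (0, 1)] j) kap s
    (\matrix_(i, j) (d i j 1%N 2%N)%:R)
    (\matrix_(i, j) (qbr q kap *+ d i j 0%N 1%N + qbr q (kap * q) *+ d i j 2%N 3%N))
    (\matrix_(i, j) (d i j 2%N 1%N)%:R)
    (\matrix_(i, j) (d i j 1%N 0%N || d i j 3%N 2%N)%:R).

Fixpoint gpow (k : fieldType) (q kap s : k) n : gmod k :=
  if n is n'.+1 then gtens q (gpow q kap s n') (gstd q kap s) else gtriv k.

Section StandardModule.
Variables (k : fieldType) (q kap s : k).
Hypotheses (q_neq0 : q != 0) (q_sub : q - q^-1 != 0).
Hypotheses (kap_neq0 : kap != 0) (s_sqr : s * s = 1).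

Lemma qbr1 : qbr q 1 = 0. Proof. by rewrite /qbr invr1 subrr mul0r. Qed.
Lemma qbrq : qbr q q = 1. Proof. by rewrite /qbr divff. Qed.
Lemma qbrV x : qbr q x^-1 = - qbr q x.
Proof. by rewrite /qbr invrK -mulNr opprB. Qed.

Lemma rels_gtriv : rels q (gtriv k).
Proof.
have deg0 m : gdeg (M := gtriv k) m 0 by move=> i j; rewrite mxE eqxx.
split => //=; rewrite /qserre ?mul0mx ?(oner_eq0, mulr1, addr0, subr0, scaler0) //.
all: by apply/matrixP => i j; rewrite !mxE /= ?mulr1 ?expr0z qbr1 mul0rn.
Qed.

Lemma rels_gstd : rels q (gstd q kap s).
Proof.
pose simps := (mulr0, mul0r, mulr1, mul1r, mulr0n, mulr1n, addr0, add0r, subr0, sub0r,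
  oppr0, expr0z, exprN1, expr1z).
have q1 : (q ^ 1 = q) * (q ^ 0 = 1) by [].
have EE : gE1 (gstd q kap s) *m gE1 (gstd q kap s) = 0.
  apply/matrixP => -[[|[|[|[|//]]]] ?] -[[|[|[|[|//]]]] ?];
  by rewrite !mxE !big_ord_recl ?big_ord0 !mxE /= !simps.
have FF : gF1 (gstd q kap s) *m gF1 (gstd q kap s) = 0.
  apply/matrixP => -[[|[|[|[|//]]]] ?] -[[|[|[|[|//]]]] ?];
  by rewrite !mxE !big_ord_recl ?big_ord0 !mxE /= !simps.
split => //.
1-4: move=> -[[|[|[|[|//]]]] ?] -[[|[|[|[|//]]]] ?];
  by rewrite mxE /= ?simps ?eqxx.
1-6: apply/matrixP => -[[|[|[|[|//]]]] ?] -[[|[|[|[|//]]]] ?];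
  rewrite !mxE /= ?big_ord_recl ?big_ord0 ?mxE /= ?simps ?q1 //;
  by rewrite ?qbr1 ?qbrq ?qbrV ?qbrq ?oppr0.
(* Since E1 and F1 have square zero on these four vectors, the Serre relations reduce to E1 E2 E1 =
   0 and F1 F2 F1 = 0. *)
all: rewrite /qserre -[in X in _ + X]mulmxA ?EE ?FF mul0mx mulmx0 addr0 sub0r.
all: apply/eqP; rewrite oppr_eq0 scaler_eq0; apply/orP; right; apply/eqP.
all: apply/matrixP => -[[|[|[|[|//]]]] ?] -[[|[|[|[|//]]]] ?];
  by rewrite mxE !big_ord_recl ?big_ord0 !mxE !big_ord_recl ?big_ord0 !mxE /= !simps.
Qed.

Lemma rels_gpow n : rels q (gpow q kap s n).
Proof.
by elim: n => [|n IH]; [exact: rels_gtriv | exact: rels_gtens rels_gstd].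
Qed.

End StandardModule.

(** * The induced structure of W *)

(** Multiplying the Serre relation by y on the left, or on the right, kills one of its outer terms;
    both results express y x x y. This is what makes T+ commute with E1 and T- with F1. *)
Lemma qserre_comm (k : fieldType) (q : k) d (x y : 'M[k]_d) :
  q + q^-1 != 0 -> qserre q x y = 0 -> y *m y = 0 ->
  y *m x *m y *m x = x *m y *m x *m y.
Proof.
move=> q2 s yy.
have sl : y *m x *m x *m y = (q + q^-1) *: (y *m x *m y *m x).
  have /eqP := congr1 (mulmx y) s; rewrite /qserre mulmx0.
  rewrite mulmxDr mulmxBr -scalemxAr !mulmxA yy !mul0mx addr0 subr_eq0.
  by move/eqP.
have sr : y *m x *m x *m y = (q + q^-1) *: (x *m y *m x *m y).
  have /eqP := congr1 (mulmx^~ y) s; rewrite /qserre mul0mx.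
  rewrite mulmxDl mulmxBl -scalemxAl -(mulmxA _ y y) yy mulmx0 sub0r addrC.
  by rewrite subr_eq0 => /eqP.
by apply: (scalerI q2); rewrite -sl -sr.
Qed.

Lemma mulqq_sub1 (k : fieldType) (q : k) :
  q != 0 -> q - q^-1 != 0 -> q * q - 1 != 0.
Proof.
move=> q0; apply: contraNneq => e; apply/eqP.
by apply: (mulfI q0); rewrite mulrBr divff // e mulr0.
Qed.

(** * The products of the odd root vectors *)

Section TopProducts.
Variables (k : fieldType) (q : k) (M : gmod k) (rM : rels q M).
Hypotheses (q_neq0 : q != 0) (q_add : q + q^-1 != 0).

(** As E2 squares to zero, this is E2 (E1 E2 - c E2 E1) for every c, the product of the two odd
    positive root vectors: a top exterior power, on which the even part acts through weights
    only. *)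
Definition Tp := locked (gE2 M *m gE1 M *m gE2 M).
Definition Tm := locked (gF2 M *m gF1 M *m gF2 M).

Lemma TpE1 : Tp *m gE1 M = gE1 M *m Tp.
Proof. by rewrite /Tp -lock (qserre_comm q_add (serreE rM) (EE22 rM)) !mulmxA. Qed.

Lemma TmF1 : Tm *m gF1 M = gF1 M *m Tm.
Proof. by rewrite /Tm -lock (qserre_comm q_add (serreF rM) (FF22 rM)) !mulmxA. Qed.

(** Commuting F1 past E1 leaves E2 D E2 with D diagonal; moving D past E2 only shifts its argument,
    and E2 E2 = 0. *)
Lemma TpF1 : Tp *m gF1 M = gF1 M *m Tp.
Proof.
have e : gE1 M *m gF1 M = gF1 M *m gE1 M + gdiag M (fun z => qbr q (q ^ z.1)).
  by rewrite -(EF11 rM) addrC subrK.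
rewrite /Tp -lock -!mulmxA (EF21 rM) (mulmxA (gE1 M)) e mulmxDl mulmxDr.
rewrite (wdiag_deg _ (degE2 rM)) !mulmxA (EE22 rM) mul0mx addr0.
by rewrite (EF21 rM).
Qed.

Lemma TmE1 : Tm *m gE1 M = gE1 M *m Tm.
Proof.
have e : gF1 M *m gE1 M = gE1 M *m gF1 M - gdiag M (fun z => qbr q (q ^ z.1)).
  by rewrite -(EF11 rM) opprB addrC subrK.
rewrite /Tm -lock -!mulmxA -(EF12 rM) (mulmxA (gF1 M)) e mulmxBl mulmxBr.
rewrite (wdiag_deg _ (degF2 rM)) !mulmxA (FF22 rM) mul0mx subr0.
by rewrite (EF12 rM).
Qed.

Lemma degTp : gdeg (M := M) (0, -1) Tp.
Proof. rewrite /Tp -lock; exact: has_degM (has_degM (degE2 rM) (degE1 rM)) (degE2 rM). Qed.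

Lemma E2Tp : gE2 M *m Tp = 0.
Proof. by rewrite /Tp -lock !mulmxA (EE22 rM) !mul0mx. Qed.
Lemma F2Tm : gF2 M *m Tm = 0.
Proof. by rewrite /Tm -lock !mulmxA (FF22 rM) !mul0mx. Qed.

End TopProducts.

(** * The embedding of X into X (x) V *)

Section Induced.
Variables (k : fieldType) (q kap s : k).
Hypotheses (q_neq0 : q != 0) (q_sub : q - q^-1 != 0) (q_add : q + q^-1 != 0).
Hypotheses (kap_neq0 : kap != 0) (s_sqr : s * s = 1).
Variables (M : gmod k) (rM : rels q M).
Local Notation S := (gstd q kap s).
Local Notation W := (gtens q M S).
Local Notation d := (gdim M).

Let rS : rels q S := rels_gstd q_sub kap_neq0 s_sqr.
Let rW : rels q W := rels_gtens q_neq0 rM rS.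

Local Notation o0 := (ord0 : 'I_4).
Local Notation o1 := (lift ord0 ord0 : 'I_4).
Local Notation o2 := (lift ord0 (lift ord0 ord0) : 'I_4).
Local Notation o3 := (lift ord0 (lift ord0 (lift ord0 ord0)) : 'I_4).
Local Notation inj := (@inj_mx k d 4).
Local Notation prj := (@prj_mx k d 4).

Definition iota_mx : 'M[k]_(gdim W, d) :=
  locked (Tp W *m inj o3).
Local Notation iota := iota_mx.

(** E1 and F1 kill v3 and its h1-weight is 0, so tensoring with it is invisible to U_q(sl(2)). *)
Lemma E1_inj3 : gE1 W *m inj o3 = inj o3 *m gE1 M.
Proof.
rewrite mulmxDl !tens_inj !big_ord_recl !big_ord0 !mxE /=.
by rewrite !(scale0r, mulr0n, mulr1n, scale1r, addr0, add0r).
Qed.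

Lemma F1_inj3 : gF1 W *m inj o3 = inj o3 *m gF1 M.
Proof.
rewrite mulmxDl !tens_inj !big_ord_recl !big_ord0 !mxE /=.
by rewrite !(scale0r, mulr0n, mulr1n, scale1r, addr0, add0r, expr0z).
Qed.

Lemma iotaE1 : gE1 W *m iota = iota *m gE1 M.
Proof. by rewrite /iota -lock mulmxA -(TpE1 rW q_add) -!mulmxA E1_inj3. Qed.

Lemma iotaF1 : gF1 W *m iota = iota *m gF1 M.
Proof. by rewrite /iota -lock mulmxA -(TpF1 rW) -!mulmxA F1_inj3. Qed.

Lemma iotaE2 : gE2 W *m iota = 0.
Proof. by rewrite /iota -lock mulmxA (E2Tp rW) mul0mx. Qed.

Lemma iota_deg : has_deg (@gwt _ W) (@gwt _ M) 0 iota.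
Proof.
(* The weight (0, 1) of v3 compensates the degree (0, -1) of T+. *)
rewrite /iota -lock; have e : 0 = (@gwt _ S o3) + (0, -1) by apply/eqP.
rewrite e.
exact: (has_degM (degTp rW) (@has_deg_inj k _ _ (@gwt _ M) (@gwt _ S) o3)).
Qed.

(** From v3 the component v0 is reached only if all three factors of T+ act on V, along v3, v2, v1,
    v0. They contribute [kap q], 1 and [kap], and leave on X their group-like coproduct parts, which
    are invertible. *)
Lemma prj_iota : prj o0 *m iota =
  (qbr q kap * qbr q (kap * q)) *:
    (gL2 q M *m gP M *m gL1 q M *m (gL2 q M *m gP M)).
Proof.
have pE2 : prj o0 *m gE2 W = gE2 M *m prj o0 +
    qbr q kap *: (gL2 q M *m gP M *m prj o1).
  rewrite mulmxDr !prj_tens !big_ord_recl !big_ord0 !mxE /=.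
  by rewrite !(scale0r, mulr0n, mulr1n, scale1r, addr0, add0r).
have pE1 : prj o0 *m gE1 W = gE1 M *m prj o0.
  rewrite mulmxDr !prj_tens !big_ord_recl !big_ord0 !mxE /=.
  by rewrite !(scale0r, mulr0n, mulr1n, scale1r, addr0, add0r).
have pE1' : prj o1 *m gE1 W = gE1 M *m prj o1 + gL1 q M *m prj o2.
  rewrite mulmxDr !prj_tens !big_ord_recl !big_ord0 !mxE /=.
  by rewrite !(scale0r, mulr0n, mulr1n, scale1r, addr0, add0r).
have iE2 : gE2 W *m inj o3 = inj o3 *m gE2 M +
    qbr q (kap * q) *: (inj o2 *m (gL2 q M *m gP M)).
  rewrite mulmxDl !tens_inj !big_ord_recl !big_ord0 !mxE /=.
  by rewrite !(scale0r, mulr0n, mulr1n, scale1r, addr0, add0r).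
rewrite /iota /Tp -!lock -!mulmxA iE2 !mulmxA pE2 mulmxDl -!mulmxA pE1.
rewrite -scalemxAl -!mulmxA pE1' !(mulmxDr, mulmxDl, =^~ scalemxAr, =^~ scalemxAl).
rewrite -!mulmxA.
have pj m m' (A : 'M[k]_d) : prj m *m (inj m' *m A) = (m == m')%:R *: A.
  by rewrite mulmxA prj_inj -scalemxAl mul1mx.
rewrite !pj /= !(scale0r, mulmx0, addr0, add0r, scaler0, scale1r, scalerA).
by [].
Qed.

Hypothesis kap_br : qbr q kap != 0.
Hypothesis kapq_br : qbr q (kap * q) != 0.

Lemma iota_inj n (x : 'M[k]_(d, n)) : iota *m x = 0 -> x = 0.
Proof.
move=> /(congr1 (mulmx (prj o0))); rewrite mulmxA prj_iota mulmx0 -scalemxAl.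
move=> /eqP; rewrite scaler_eq0 mulf_eq0 (negPf kap_br) (negPf kapq_br) /=.
move=> /eqP e.
have K2P (y : 'M[k]_(d, n)) : gL2 q M *m gP M *m y = 0 -> y = 0.
  move=> /(congr1 (mulmx (gP M *m gK2 q M))).
  rewrite mulmx0 -!mulmxA (mulmxA (gK2 q M)) (K2L2 q_neq0 rM) mul1mx.
  by rewrite mulmxA (PP rM) mul1mx.
apply: (K2P); move: e; rewrite -!mulmxA mulmxA => /K2P.
move=> /(congr1 (mulmx (gK1 q M))).
by rewrite mulmx0 !mulmxA (K1L1 q_neq0) mul1mx.
Qed.

End Induced.

(** * W as four copies of X, and the comparison of commutants *)

Section Reconstruction.
Variables (k : fieldType) (q : k).
Hypotheses (q_neq0 : q != 0) (q_sub : q - q^-1 != 0) (q_add : q + q^-1 != 0).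
Variables (M W : gmod k) (rM : rels q M) (rW : rels q W).
Local Notation d := (gdim M).
Local Notation c := (gc W).

Variable iota : 'M[k]_(gdim W, d).
Hypotheses (iotaE1 : gE1 W *m iota = iota *m gE1 M)
  (iotaF1 : gF1 W *m iota = iota *m gF1 M)
  (iotaE2 : gE2 W *m iota = 0)
  (iota_deg : has_deg (@gwt _ W) (@gwt _ M) 0 iota)
  (iota_inj : forall n (x : 'M[k]_(d, n)), iota *m x = 0 -> x = 0).

Lemma iota_diag g : gdiag W g *m iota = iota *m gdiag M g.
Proof.
rewrite /gdiag (wdiag_deg _ iota_deg); congr (_ *m _).
by apply: eq_wdiag => z; rewrite addr0.
Qed.

Local Notation o0 := (ord0 : 'I_4).
Local Notation o1 := (lift ord0 ord0 : 'I_4).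
Local Notation o2 := (lift ord0 (lift ord0 ord0) : 'I_4).
Local Notation o3 := (lift ord0 (lift ord0 (lift ord0 ord0)) : 'I_4).
Hypothesis iota_Tp : exists a : 'M[k]_(gdim W, d), iota = Tp W *m a.

Variables (inj : 'I_4 -> 'M[k]_(gdim W, d)) (prj : 'I_4 -> 'M[k]_(d, gdim W)).
Hypotheses (prj_inj : forall m m', prj m *m inj m' = (m == m')%:R *: 1%:M)
  (sum_inj_prj : \sum_m inj m *m prj m = 1%:M).

Lemma iota_injD n (x y : 'M[k]_(d, n)) : iota *m x = iota *m y -> x = y.
Proof.
move=> /eqP; rewrite -subr_eq0 -mulmxBr => /eqP/iota_inj/eqP.
by rewrite subr_eq0 => /eqP.
Qed.

(** The product [h2] [h1 + h2 + 1] over the two odd positive roots, evaluated at weights of W. It is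
    the value of T+ T- on vectors of iota X killed by E1; the term - F1 E1 of [theta] accounts for
    the others. *)
Definition theta_diag : 'M[k]_d := gdiag M (fun z =>
  qbr q (c * q ^ z.2) * qbr q (q * q ^ z.1 * (c * q ^ z.2))).
Definition theta := theta_diag - gF1 M *m gE1 M.

Let B := gdiag M (fun z => qbr q (c * q ^ z.2)).

Lemma E2F2_iota : gE2 W *m (gF2 W *m iota) = iota *m B.
Proof.
have e : gE2 W *m gF2 W = gdiag W (fun z => qbr q (c * q ^ z.2)) - gF2 W *m gE2 W.
  by rewrite -(EF22 rW) addrK.
by rewrite mulmxA e mulmxBl -mulmxA iotaE2 mulmx0 subr0 iota_diag.
Qed.

Lemma E2F1F2_iota :
  gE2 W *m (gF1 W *m (gF2 W *m iota)) = iota *m (gF1 M *m B).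
Proof. by rewrite mulmxA (EF21 rW) -mulmxA E2F2_iota mulmxA iotaF1 -mulmxA. Qed.

Let B1 := gdiag M (fun z => qbr q (c * q ^ (z.2 + 1))).
Let K' := gdiag M (fun z => qbr q (q ^ (z.1 + 1))).

Lemma E2F2F1F2_iota : gE2 W *m (gF2 W *m (gF1 W *m (gF2 W *m iota))) =
    gF1 W *m (gF2 W *m iota) *m B1 - gF2 W *m iota *m (gF1 M *m B).
Proof.
  have e : gE2 W *m gF2 W = gdiag W (fun z => qbr q (c * q ^ z.2)) - gF2 W *m gE2 W.
    by rewrite -(EF22 rW) addrK.
  rewrite mulmxA e mulmxBl -(mulmxA _ (gE2 W)) E2F1F2_iota !mulmxA; congr (_ - _).
  rewrite [gdiag W _ *m _](wdiag_deg _ (degF1 rW)) -(mulmxA _ (wdiag _ _)).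
  rewrite [_ *m gF2 W](wdiag_deg _ (degF2 rW)). rewrite mulmxA -!(mulmxA _ _ iota).
  rewrite [_ *m iota]iota_diag !mulmxA; congr (_ *m _).
  by apply: eq_wdiag => z /=; rewrite -addrA.
Qed.

Lemma E1F1F2_iota : gE1 W *m (gF1 W *m (gF2 W *m iota)) =
    gF1 W *m (gF2 W *m iota) *m gE1 M + gF2 W *m iota *m K'.
Proof.
  have e : gE1 W *m gF1 W = gF1 W *m gE1 W + gdiag W (fun z => qbr q (q ^ z.1)).
    by rewrite -(EF11 rW) addrC subrK.
  rewrite mulmxA e mulmxDl; congr (_ + _).
    by rewrite -mulmxA (mulmxA (gE1 W)) (EF12 rW) -(mulmxA _ _ iota) iotaE1 !mulmxA.
  rewrite mulmxA [_ *m gF2 W](wdiag_deg _ (degF2 rW)) -!mulmxA; congr (_ *m _).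
  by rewrite [_ *m iota]iota_diag.
Qed.

Lemma E1F2_iota : gE1 W *m (gF2 W *m iota) = gF2 W *m iota *m gE1 M.
Proof.
  by rewrite mulmxA (EF12 rW) -mulmxA iotaE1 mulmxA.
Qed.

Lemma Tp_Tm_iota : Tp W *m (Tm W *m iota) = iota *m theta.
Proof.
pose K := gdiag M (fun z => qbr q (q ^ z.1)).
pose Bs := gdiag M (fun z => qbr q (c * q ^ (z.2 - 1))).
have -> : Tp W *m (Tm W *m iota) =
    iota *m (gF1 M *m B *m gE1 M *m B1 + B *m K' *m B1 - B *m gE1 M *m gF1 M *m B).
  have f1 (Y : 'M_d) : gE1 W *m (gF1 W *m (gF2 W *m (iota *m Y))) =
      gF1 W *m (gF2 W *m (iota *m (gE1 M *m Y))) + gF2 W *m (iota *m (K' *m Y)).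
    by have := congr1 (mulmx^~ Y) E1F1F2_iota; rewrite /= mulmxDl -!mulmxA.
  have f2 (Y : 'M_d) : gE1 W *m (gF2 W *m (iota *m Y)) =
      gF2 W *m (iota *m (gE1 M *m Y)).
    by have := congr1 (mulmx^~ Y) E1F2_iota; rewrite /= -!mulmxA.
  have f3 (Y : 'M_d) : gE2 W *m (gF2 W *m (iota *m Y)) = iota *m (B *m Y).
    by have := congr1 (mulmx^~ Y) E2F2_iota; rewrite /= -!mulmxA.
  have f4 (Y : 'M_d) : gE2 W *m (gF1 W *m (gF2 W *m (iota *m Y))) =
      iota *m (gF1 M *m (B *m Y)).
    by have := congr1 (mulmx^~ Y) E2F1F2_iota; rewrite /= -!mulmxA.
  rewrite /Tp /Tm -!lock -!mulmxA E2F2F1F2_iota 2!mulmxBr -!mulmxA f1 f2 [gE2 W *m (_ + _)]mulmxDr.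
  by rewrite f4 !f3 -mulmxDr -mulmxBr.
congr (_ *m _).
have eE : B *m gE1 M = gE1 M *m Bs by rewrite [LHS](wdiag_deg _ (degE1 rM)).
have eF : B *m (gF1 M *m gE1 M) = gF1 M *m gE1 M *m B.
  rewrite [LHS](wdiag_deg _ (has_degM (degF1 rM) (degE1 rM))); congr (_ *m _).
  by apply: eq_wdiag => z /=; rewrite subrr addr0.
have eEF : gE1 M *m gF1 M = gF1 M *m gE1 M + K by rewrite /K -(EF11 rM) addrC subrK.
have s1 : gF1 M *m B *m gE1 M *m B1 = gF1 M *m gE1 M *m (Bs *m B1).
  by rewrite -(mulmxA (gF1 M)) eE !mulmxA.
have s2 : B *m gE1 M *m gF1 M *m B = gF1 M *m gE1 M *m (B *m B) + B *m K *m B.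
  by rewrite -(mulmxA B) eEF mulmxDr eF mulmxDl -(mulmxA _ B B).
have qq1 := mulqq_sub1 q_neq0 q_sub.
(* With a and b the weights of h1 and h2, two scalar identities remain: [b] ([a+1] [b+1] - [a] [b])
   = [b] [a+b+1] and [b-1] [b+1] - [b]^2 = -1. *)
rewrite s1 s2 opprD addrACA -mulmxBr !wdiagM !wdiagB addrC; congr (_ + _).
  apply: eq_wdiag => z /=; rewrite /qbr !expfzDr // expr1z.
  have := expfz_neq0 z.1 q_neq0; have := expfz_neq0 z.2 q_neq0.
  move: (q ^ z.1) (q ^ z.2) => x y y0 x0; field.
  by rewrite q_neq0 qq1 y0 (c_neq0 rW) x0.
transitivity (gF1 M *m gE1 M *m (-1)%:M); last by rewrite mul_mx_scalar scaleN1r.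
congr (_ *m _); rewrite -(wdiag_const (@gwt _ M)); apply: eq_wdiag => z /=.
rewrite /qbr !expfzDr // expr1z exprN1.
have := expfz_neq0 z.2 q_neq0; move: (q ^ z.2) => y y0; field.
by rewrite q_neq0 qq1 y0 (c_neq0 rW).
Qed.

(** Through the injective [iota], [theta] is T+ T-, and T+, T- and [iota] all commute with E1. *)
Lemma theta_E1 : theta *m gE1 M = gE1 M *m theta.
Proof.
have TpTmE1 : Tp W *m (Tm W *m iota) *m gE1 M = gE1 W *m (Tp W *m (Tm W *m iota)).
  rewrite -!mulmxA -iotaE1 (mulmxA (Tm W)) (TmE1 rW) -(mulmxA (gE1 W)).
  by rewrite mulmxA (TpE1 rW q_add) -mulmxA.
by apply: iota_injD; rewrite !mulmxA -Tp_Tm_iota TpTmE1 -iotaE1 -mulmxA Tp_Tm_iota.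
Qed.

(** The kernel of D - B' A is stable under the nilpotent A. If it were nonzero it would contain a
    nonzero vector killed by A, and there D - B' A coincides with the injective D. *)
Lemma nilp_inj n d' (A D : 'M[k]_d') (B' : 'M[k]_d') :
  A ^+ n = 0 -> (D - B' *m A) *m A = A *m (D - B' *m A) ->
  (forall x : 'cV_d', D *m x = 0 -> x = 0) ->
  forall x : 'cV_d', (D - B' *m A) *m x = 0 -> x = 0.
Proof.
move=> An0 AC Dinj.
have {An0} : forall x : 'cV_d', A ^+ n *m x = 0 by move=> x; rewrite An0 mul0mx.
move=> An0 x Tx; have := An0 x.
elim: n {An0} x Tx => [|n IH] x Tx; first by rewrite expr0 mul1mx.
rewrite exprSr -mulmxA => Ax.
have Ax0 : A *m x = 0 by apply: IH => //; rewrite mulmxA AC -mulmxA Tx mulmx0.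
by apply: Dinj; move: Tx; rewrite mulmxBl -mulmxA Ax0 mulmx0 subr0.
Qed.

Hypothesis E1_nilp : exists n, gE1 M ^+ n = 0.
Hypothesis typical : forall z : int, qbr q (c * q ^ z) != 0.

Lemma theta_inj n (x : 'M[k]_(d, n)) : theta *m x = 0 -> x = 0.
Proof.
have [m Em] := E1_nilp.
move=> tx; suff col0 j : col j x = 0.
  by apply/matrixP => i j; have /colP/(_ i) := col0 j; rewrite !mxE.
apply: (nilp_inj Em theta_E1); last first.
  by rewrite colE mulmxA tx mul0mx.
move=> y /colP Dy; apply/colP => i; have := Dy i.
rewrite mul_diag_mx !mxE => /eqP; rewrite mulf_eq0 mulf_eq0 (negPf (typical _)) /=.
case/orP=> [|/eqP //]; set w := gwt i.
(* The second root factor again has the form [c q^z], so [typical] covers it too. *)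
have -> : q * q ^ w.1 * (c * q ^ w.2) = c * q ^ (1 + w.1 + w.2).
  by rewrite !expfzDr // expr1z; ring.
by rewrite (negPf (typical _)).
Qed.

(** The coordinates of W itself, cut into four blocks by [prj], serve as source of the four copies
    of X. The matrix is thus square, and injectivity alone yields the decomposition. *)
Definition J_mx : 'M[k]_(gdim W) :=
  iota *m prj o0 + gF2 W *m iota *m prj o1 +
  gF1 W *m (gF2 W *m iota) *m prj o2 + Tm W *m iota *m prj o3.

Lemma Tm_iota_inj n (x : 'M[k]_(d, n)) : Tm W *m iota *m x = 0 -> x = 0.
Proof.
move=> /(congr1 (mulmx (Tp W))); rewrite mulmx0 mulmxA Tp_Tm_iota -mulmxA.
by move=> /iota_inj/theta_inj.
Qed.

Lemma TpF2_iota : Tp W *m (gF2 W *m iota) = 0.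
Proof.
rewrite /Tp -lock -!mulmxA E2F2_iota (mulmxA (gE1 W)) iotaE1 -mulmxA.
by rewrite (mulmxA (gE2 W)) iotaE2 mul0mx.
Qed.

Lemma TpF1F2_iota : Tp W *m (gF1 W *m (gF2 W *m iota)) = 0.
Proof.
rewrite mulmxA (TpF1 rW) -mulmxA TpF2_iota mulmx0 //.
Qed.

Lemma Tp_iota : Tp W *m iota = 0.
Proof. by rewrite /Tp -lock -!mulmxA iotaE2 !mulmx0. Qed.

(** T+ kills the first three blocks and is injective on the block of T-, which gives x3 = 0.
    Multiplying by F2, or by F2 F1, then moves the blocks of x2, x0 and x1 in turn to the block of
    T-. *)
Lemma J_inj (x : 'cV[k]_(gdim W)) : J_mx *m x = 0 -> x = 0.
Proof.
move=> Jx; have blocks : x = \sum_m inj m *m (prj m *m x).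
  under eq_bigr => m _ do rewrite mulmxA.
  by rewrite -mulmx_suml sum_inj_prj mul1mx.
set x0 := prj o0 *m x; set x1 := prj o1 *m x; set x2 := prj o2 *m x.
set x3 := prj o3 *m x.
have {}Jx : iota *m x0 + gF2 W *m iota *m x1 + gF1 W *m gF2 W *m iota *m x2
    + Tm W *m iota *m x3 = 0 by rewrite -Jx !mulmxDl !mulmxA.
have F2F2I : gF2 W *m (gF2 W *m iota) = 0 by rewrite mulmxA (FF22 rW) mul0mx.
have TmE : gF2 W *m (gF1 W *m gF2 W *m iota) = Tm W *m iota.
  by rewrite /Tm -lock !mulmxA.
have z3 : x3 = 0.
  move/(congr1 (mulmx (Tp W))): Jx; rewrite mulmx0 3!mulmxDr.
  rewrite [_ *m (_ *m x0)]mulmxA [_ *m (_ *m x1)]mulmxA [_ *m (_ *m x2)]mulmxA.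
  rewrite [_ *m (_ *m x3)]mulmxA Tp_iota TpF2_iota -(mulmxA (gF1 W)) TpF1F2_iota Tp_Tm_iota !mul0mx !add0r -mulmxA.
  by move/iota_inj/theta_inj.
rewrite z3 mulmx0 addr0 in Jx.
have z2 : x2 = 0.
  move/(congr1 (mulmx (gF2 W))): (Jx); rewrite mulmx0 2!mulmxDr.
  rewrite [_ *m (_ *m x0)]mulmxA [_ *m (_ *m x1)]mulmxA [_ *m (_ *m x2)]mulmxA.
  rewrite F2F2I TmE mul0mx addr0 => /(congr1 (mulmx (Tp W))); rewrite mulmx0 mulmxDr.
  rewrite [_ *m (_ *m x0)]mulmxA [_ *m (_ *m x2)]mulmxA.
  rewrite TpF2_iota mul0mx add0r Tp_Tm_iota -mulmxA.
  by move/iota_inj/theta_inj.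
rewrite z2 mulmx0 addr0 in Jx.
have z0 : x0 = 0.
  move/(congr1 (mulmx (gF2 W))): (Jx); rewrite mulmx0 mulmxDr.
  rewrite [_ *m (_ *m x0)]mulmxA [_ *m (_ *m x1)]mulmxA F2F2I mul0mx addr0.
  move=> e; apply: Tm_iota_inj; rewrite -TmE.
  by rewrite -!mulmxA [gF2 W *m (iota *m x0)]mulmxA e !mulmx0.
rewrite z0 mulmx0 add0r in Jx.
have z1 : x1 = 0.
  apply: Tm_iota_inj; rewrite -TmE.
  by rewrite -!mulmxA [gF2 W *m (iota *m x1)]mulmxA Jx !mulmx0.
rewrite blocks !big_ord_recl big_ord0 -/x0 -/x1 -/x2 -/x3.
by rewrite z0 z1 z2 z3 !mulmx0 !addr0.
Qed.

Lemma J_unit : J_mx \in unitmx.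
Proof.
rewrite -unitmx_tr -row_free_unit -kermx_eq0; apply/eqP/row_matrixP => i.
rewrite row0; apply: trmx_inj; rewrite trmx0; apply: J_inj.
apply: trmx_inj; rewrite trmx_mul trmxK trmx0.
by rewrite -row_mul mulmx_ker row0.
Qed.

Local Notation J0 := iota.
Local Notation J1 := (gF2 W *m iota).
Local Notation J2 := (gF1 W *m (gF2 W *m iota)).
Local Notation J3 := (Tm W *m iota).

Lemma mulmx_J n (A : 'M[k]_(n, gdim W)) :
  A *m J_mx = A *m J0 *m prj o0 + A *m J1 *m prj o1 +
              A *m J2 *m prj o2 + A *m J3 *m prj o3.
Proof. by rewrite /J_mx 3!mulmxDr !(mulmxA A). Qed.

Lemma eq_mulmx_J (A A' : 'M[k]_(gdim W)) :
  A *m J0 = A' *m J0 -> A *m J1 = A' *m J1 ->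
  A *m J2 = A' *m J2 -> A *m J3 = A' *m J3 -> A = A'.
Proof.
move=> e0 e1 e2 e3; have : A *m J_mx = A' *m J_mx.
  by rewrite !mulmx_J e0 e1 e2 e3.
by move/(congr1 (mulmx^~ (invmx J_mx))); rewrite /= !(mulmxK J_unit).
Qed.

Lemma J_blocks : [/\ J_mx *m inj o0 = J0, J_mx *m inj o1 = J1,
  J_mx *m inj o2 = J2 & J_mx *m inj o3 = J3].
Proof.
have pj n m m' (A : 'M[k]_(n, d)) : A *m prj m *m inj m' = (m == m')%:R *: A.
  by rewrite -mulmxA prj_inj -scalemxAr mulmx1.
by split; rewrite 3!mulmxDl !pj /= !scale0r scale1r ?addr0 ?add0r.
Qed.

(* The commutant of U_q(sl(2|1)), resp. of U_q(gl(2)). *)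
Definition gcomm (L : gmod k) (f : 'M[k]_(gdim L)) : Prop :=
  gdeg (M := L) 0 f /\
  [/\ gE1 L *m f = f *m gE1 L, gE2 L *m f = f *m gE2 L,
      gF1 L *m f = f *m gF1 L & gF2 L *m f = f *m gF2 L].

Definition ecomm (L : gmod k) (f : 'M[k]_(gdim L)) : Prop :=
  [/\ gdeg (M := L) 0 f, gE1 L *m f = f *m gE1 L & gF1 L *m f = f *m gF1 L].

Definition induced_map (g : 'M[k]_d) : 'M[k]_(gdim W) :=
  J_mx *m (\sum_m inj m *m g *m prj m) *m invmx J_mx.

Lemma deg0_diag (L : gmod k) (f : 'M[k]_(gdim L)) :
  gdeg (M := L) 0 f <-> forall h, gdiag L h *m f = f *m gdiag L h.
Proof.
split=> [df h | fC i j fij].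
  rewrite /gdiag (wdiag_deg _ df); congr (_ *m _).
  by apply: eq_wdiag => z; rewrite addr0.
(* The indicator of one weight separates it from all others. *)
have /matrixP/(_ i j) := fC (fun z => (z == gwt i)%:R).
rewrite mul_diag_mx mul_mx_diag !mxE eqxx mul1r addr0.
by case: eqP => // _ /eqP; rewrite mulr0 (negPf fij).
Qed.

Lemma induced_J (g : 'M[k]_d) :
  [/\ induced_map g *m J0 = J0 *m g, induced_map g *m J1 = J1 *m g,
     induced_map g *m J2 = J2 *m g & induced_map g *m J3 = J3 *m g].
Proof.
have fJ : induced_map g *m J_mx = J_mx *m (\sum_m inj m *m g *m prj m) by rewrite mulmxKV ?J_unit.
have gi m : (\sum_m inj m *m g *m prj m) *m inj m = inj m *m g.
  rewrite mulmx_suml (bigD1 m) //= -mulmxA prj_inj eqxx scale1r mulmx1.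
  by rewrite big1 ?addr0 // => l ne; rewrite -mulmxA prj_inj (negPf ne) scale0r mulmx0.
have fi m : induced_map g *m (J_mx *m inj m) = J_mx *m inj m *m g.
  by rewrite mulmxA fJ -!mulmxA gi.
by have [<- <- <- <-] := J_blocks.
Qed.

(* On each block J_m, a generator acts by matrices of U_q(gl(2)) type. *)
Lemma induced_map_gcomm (g : 'M[k]_d) : ecomm g -> gcomm (induced_map g).
Proof.
case=> dg gE gF; have [f0 f1 f2 f3] := induced_J g; set f := induced_map g in f0 f1 f2 f3 *.
have [gD] : (forall h, gdiag M h *m g = g *m gdiag M h) /\ True.
  by split=> //; apply/deg0_diag.
move=> _.
have comm Y : Y *m J0 *m g = f *m (Y *m J0) -> Y *m J1 *m g = f *m (Y *m J1) ->
    Y *m J2 *m g = f *m (Y *m J2) -> Y *m J3 *m g = f *m (Y *m J3) ->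
    Y *m f = f *m Y.
  move=> h0 h1 h2 h3; apply: eq_mulmx_J; rewrite -(mulmxA Y) -(mulmxA f).
  - by rewrite f0 mulmxA.
  - by rewrite f1 mulmxA.
  - by rewrite f2 mulmxA.
  - by rewrite f3 mulmxA.
have J3E : gF2 W *m J2 = J3 by rewrite /Tm -lock !mulmxA.
have F2F2 : gF2 W *m J1 = 0 by rewrite mulmxA (FF22 rW) mul0mx.
have F2J3 : gF2 W *m J3 = 0 by rewrite mulmxA (F2Tm rW) mul0mx.
have E1J3 : gE1 W *m J3 = J3 *m gE1 M.
  by rewrite mulmxA -(TmE1 rW) -mulmxA iotaE1 mulmxA.
have F1J3 : gF1 W *m J3 = J3 *m gF1 M.
  by rewrite mulmxA -(TmF1 rW q_add) -mulmxA iotaF1 mulmxA.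
(* The Serre relation rewrites F1 F1 F2 so that F1 maps the block of F1 F2 into itself plus the
   block of F2. *)
have F1J2 : gF1 W *m J2 = J2 *m ((q + q^-1) *: gF1 M) - J1 *m (gF1 M *m gF1 M).
  have /eqP := serreF rW; rewrite /qserre addrAC subr_eq0 => /eqP.
  move=> /(congr1 (mulmx^~ iota)); rewrite /= mulmxDl -!scalemxAl -!mulmxA.
  move=> /(canRL (addrK _)) ->; rewrite -!scalemxAr; congr (_ *: _ - _).
    by rewrite iotaF1.
  by rewrite iotaF1 (mulmxA _ J0) iotaF1 -(mulmxA J0).
split.
  apply/deg0_diag => h; have dJ m J : has_deg (@gwt _ W) (@gwt _ M) m J ->
      f *m J = J *m g -> gdiag W h *m J *m g = f *m (gdiag W h *m J).
    move=> dJ fJm; rewrite [gdiag W h *m J](wdiag_deg _ dJ) [RHS]mulmxA fJm.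
    by rewrite -!mulmxA; congr (_ *m _); exact: gD.
  apply: comm.
  - exact: dJ iota_deg f0.
  - exact: dJ (has_degM (degF2 rW) iota_deg) f1.
  - exact: dJ (has_degM (degF1 rW) (has_degM (degF2 rW) iota_deg)) f2.
  - rewrite -J3E in f3 *.
    exact: dJ (has_degM (degF2 rW) (has_degM (degF1 rW) (has_degM (degF2 rW) iota_deg))) f3.
split; apply: comm.
- by rewrite iotaE1 (mulmxA f J0) f0 -(mulmxA J0) gE mulmxA.
- by rewrite E1F2_iota (mulmxA f J1) f1 -(mulmxA J1) gE mulmxA.
- rewrite E1F1F2_iota mulmxDr (mulmxA f J2) (mulmxA f J1) f2 f1 mulmxDl -(mulmxA J2) gE.
  by rewrite -(mulmxA J1 _ g) gD (mulmxA J1) (mulmxA J2).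
- by rewrite E1J3 (mulmxA f J3) f3 -(mulmxA J3) gE mulmxA.
- by rewrite iotaE2 mul0mx mulmx0.
- by rewrite E2F2_iota (mulmxA f J0) f0 -(mulmxA J0) gD mulmxA.
- rewrite E2F1F2_iota (mulmxA f J0) f0 -(mulmxA J0) -(mulmxA (gF1 M)) gD.
  by rewrite (mulmxA (gF1 M)) gF !mulmxA.
- rewrite -J3E E2F2F1F2_iota mulmxBr (mulmxA f J2) (mulmxA f J1) f2 f1 mulmxBl -(mulmxA J2 B1) gD.
  rewrite -(mulmxA J1 _ g) -(mulmxA (gF1 M) _ g) gD (mulmxA (gF1 M)) gF.
  by rewrite (mulmxA J2) -(mulmxA g) (mulmxA J1).
- by rewrite iotaF1 (mulmxA f J0) f0 -(mulmxA J0) gF mulmxA.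
- by rewrite f2.
- rewrite F1J2 mulmxBr (mulmxA f J2) (mulmxA f J1) f2 f1 mulmxBl -(mulmxA J2 (_ *: _)) -scalemxAl gF.
  rewrite -(mulmxA J1 _ g) -(mulmxA (gF1 M) _ g) gF (mulmxA (gF1 M)) gF.
  by rewrite scalemxAr (mulmxA J2) -(mulmxA g) (mulmxA J1).
- by rewrite F1J3 (mulmxA f J3) f3 -(mulmxA J3) gF mulmxA.
- by rewrite f1.
- by rewrite F2F2 mul0mx mulmx0.
- by rewrite J3E f3.
- by rewrite F2J3 mul0mx mulmx0.
Qed.

(** T+ factors through [iota] and [iota] through T+, so both have the same image. As f commutes with
    T+ it preserves this image and restricts to some g; the other blocks come from it by F1 and F2,
    with which f commutes. *)
Lemma gcomm_induced_map (f : 'M[k]_(gdim W)) :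
  gcomm f -> exists2 g : 'M[k]_d, ecomm g & f = induced_map g.
Proof.
case=> df [fE1 fE2 fF1 fF2].
have fTp : f *m Tp W = Tp W *m f.
  rewrite /Tp -lock !mulmxA -fE2 -(mulmxA _ f) -fE1 !mulmxA.
  by rewrite -(mulmxA _ f) -fE2 !mulmxA.
have fTm : f *m Tm W = Tm W *m f.
  rewrite /Tm -lock !mulmxA -fF2 -(mulmxA _ f) -fF1 !mulmxA.
  by rewrite -(mulmxA _ f) -fF2 !mulmxA.
have TpE : Tp W = iota *m (theta *m prj o3 *m invmx J_mx).
  rewrite -[LHS](mulmxK J_unit) mulmx_J Tp_iota TpF2_iota TpF1F2_iota Tp_Tm_iota.
  by rewrite !mul0mx !add0r !mulmxA.
have [a iotaE] := iota_Tp.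
(* Read off from f iota = f T+ a = T+ f a and the factorization of T+ through [iota]. *)
pose g := theta *m prj o3 *m invmx J_mx *m f *m a.
have f0 : f *m J0 = J0 *m g.
  by rewrite {1}iotaE mulmxA fTp TpE !mulmxA.
have f1 : f *m J1 = J1 *m g by rewrite mulmxA -fF2 -mulmxA f0 mulmxA.
have f2 : f *m J2 = J2 *m g.
  by rewrite (mulmxA f) -fF1 -(mulmxA (gF1 W)) f1 (mulmxA (gF1 W)).
have f3 : f *m J3 = J3 *m g by rewrite mulmxA fTm -(mulmxA (Tm W)) f0 mulmxA.
exists g; last first.
  have [h0 h1 h2 h3] := induced_J g.
  by apply: eq_mulmx_J; rewrite (h0, h1, h2, h3).
have comm Y X : Y *m J0 = J0 *m X -> Y *m f = f *m Y -> X *m g = g *m X.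
  move=> YX Yf; apply: iota_injD.
  by rewrite mulmxA -YX -mulmxA -f0 mulmxA Yf -mulmxA YX mulmxA f0 -mulmxA.
split; [|exact: comm iotaE1 fE1|exact: comm iotaF1 fF1].
apply/deg0_diag => h; apply: comm (iota_diag h) _.
by have [dd _] := deg0_diag f; apply: dd.
Qed.

Lemma induced_map_is_linear : linear induced_map.
Proof.
move=> x a b; rewrite /induced_map scalemxAl scalemxAr -mulmxDl -mulmxDr.
congr (_ *m _ *m _); rewrite scaler_sumr -big_split; apply: eq_bigr => m _ /=.
by rewrite mulmxDr mulmxDl -scalemxAr -scalemxAl.
Qed.

Lemma induced_map_inj (g : 'M[k]_d) : induced_map g = 0 -> g = 0.
Proof.
move=> g0; have [f0 _ _ _] := induced_J g.
by apply: iota_inj; rewrite -f0 g0 mul0mx.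
Qed.

End Reconstruction.

(** * The commutant of U_q(gl(2)) *)

Section QuantumSL2.
Variables (k : fieldType) (q : k).
Hypotheses (q_neq0 : q != 0) (q_sub : q - q^-1 != 0).
Hypothesis q_gen : forall z : int, q ^ z = 1 -> z = 0.

Lemma qbr_gen (z : int) : z != 0 -> qbr q (q ^ z) != 0.
Proof.
move=> z0; rewrite /qbr mulf_neq0 ?invr_eq0 // subr_eq0.
apply: contra_neq z0 => e; have : q ^ (z + z) = 1.
  by rewrite expfzDr // {1}e mulVf // expfz_neq0.
by move/q_gen; lia.
Qed.

(** The step [n] [n+1] + [2n+2] = [n+1] [n+2] of both recursions below: it sums the brackets
    collected when e passes powers of f, or f passes powers of e. *)
Lemma qbr_step (n : nat) :
  qbr q (q ^ n) * qbr q (q ^ n.+1) + qbr q (q ^ (n.+1%:Z + n.+1%:Z)) =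
  qbr q (q ^ n.+1) * qbr q (q ^ n.+2).
Proof.
have qq1 := mulqq_sub1 q_neq0 q_sub.
rewrite expfzDr // -!exprnP !exprSr /qbr.
have := expf_neq0 n q_neq0; move: (q ^+ n) => x x0; field.
by rewrite q_neq0 qq1 x0.
Qed.

(** [wtv j x] stands for weight 2j, whence [j + j] in the commutation rule: only even weights are
    relevant here. *)
Variables (U : lmodType k) (e f : {linear U -> U}) (wtv : int -> U -> Prop).
Hypotheses (e_wt : forall j x, wtv j x -> wtv (j + 1) (e x))
  (f_wt : forall j x, wtv j x -> wtv (j - 1) (f x))
  (ef_comm : forall j x, wtv j x -> e (f x) - f (e x) = qbr q (q ^ (j + j)) *: x).

(** One has e f^(j+1) x = - [j] [j+1] f^j x. For j > 0 the coefficient is nonzero, so the vanishing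
    of a power of f on x descends; it vanishes at j = 0, where the descent stops at f x = 0. *)
Lemma sl2_invariant x : (exists n, iter n f x = 0) ->
  wtv 0 x -> e x = 0 -> f x = 0.
Proof.
move=> [n fn0] x0 ex.
have wx j : wtv (- j%:Z) (iter j f x).
  elim: j => [|j IH]; first by rewrite oppr0.
  by have := f_wt IH; congr wtv; lia.
have ef j : e (iter j.+1 f x) =
    - (qbr q (q ^ j) * qbr q (q ^ j.+1)) *: iter j f x.
  elim: j => [|j IH].
    have := ef_comm x0; rewrite ex linear0 subr0 /= => ->.
    by rewrite addr0 expr0z qbr1 mul0r oppr0 !scale0r.
  have := ef_comm (wx j.+1); rewrite IH linearZ /= => /(canRL (subrK _)) ->.
  rewrite -scalerDl; congr (_ *: _); rewrite -(qbr_step j) opprD [RHS]addrC.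
  by congr (_ - _); rewrite -qbrV; rewrite invr_expz; congr (qbr q (q ^ _)); lia.
elim: n fn0 => [|[//|n] IH] fn0; first by rewrite /= in fn0; rewrite fn0 linear0.
apply: IH; have := ef n.+1; rewrite fn0 linear0 => /esym/eqP.
by rewrite scaler_eq0 oppr_eq0 mulf_eq0 !(negPf (qbr_gen _)) //= => /eqP.
Qed.

(** Here f e^(j+1) y = - [j+1] [j+2] e^j y, whose coefficient never vanishes, so the descent reaches
    y. In finite dimension this makes e surjective from weight 0 onto weight 2. *)
Lemma sl2_ef_inj y : (exists n, iter n e y = 0) ->
  wtv 1 y -> e (f y) = 0 -> y = 0.
Proof.
move=> [n en0] y1 efy.
have wy j : wtv (1 + j%:Z) (iter j e y).
  elim: j => [|j IH]; first by rewrite addr0.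
  by have := e_wt IH; congr wtv; lia.
have fe j : f (iter j.+1 e y) =
    - (qbr q (q ^ j.+1) * qbr q (q ^ j.+2)) *: iter j e y.
  elim: j => [|j IH].
    have := ef_comm y1; rewrite efy sub0r /= => /(canRL (@opprK _)) ->.
    by rewrite -scaleNr; congr (- _ *: _); rewrite expr1z qbrq // mul1r.
  have := ef_comm (wy j.+1); rewrite IH linearZ /= => /(canRL (subKr _)) ->.
  rewrite -scalerBl -(qbr_step j.+1); congr (_ *: _); rewrite opprD; congr (_ - _).
elim: n en0 => [//|n IH] en0; apply: IH.
have := fe n; rewrite en0 linear0 => /esym/eqP.
by rewrite scaler_eq0 oppr_eq0 mulf_eq0 !(negPf (qbr_gen _)) //= => /eqP.
Qed.

End QuantumSL2.

(** * Matrices with prescribed support *)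

Section DegreeSpaces.
Variables (k : fieldType) (a b : nat).
Implicit Types (S : pred ('I_a * 'I_b)) (A : 'M[k]_(a, b)).

Definition mask S A : 'M[k]_(a, b) := \matrix_(i, j) (A i j *+ S (i, j)).

Lemma mask_is_linear S : linear (mask S).
Proof.
move=> c A B; apply/matrixP => i j; rewrite !mxE.
by case: (S _); rewrite ?mulr1n ?mulr0n ?mulr0 ?addr0.
Qed.
HB.instance Definition _ S :=
  GRing.isLinear.Build k 'M[k]_(a, b) 'M[k]_(a, b) *:%R (mask S) (mask_is_linear S).

Definition suppv S : {vspace 'M[k]_(a, b)} := lker (linfun (mask (predC S))).

Lemma mem_suppv S A : A \in suppv S <-> forall i j, A i j != 0 -> S (i, j).
Proof.
rewrite memv_ker lfunE /=; split=> [/eqP/matrixP m0 i j Aij|AS].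
  have := m0 i j; rewrite !mxE /=; case: (S _) => //= /eqP.
  by rewrite mulr1n (negPf Aij).
apply/eqP/matrixP => i j; rewrite !mxE /=.
have [->|/AS ->] := eqVneq (A i j) 0; first by rewrite mul0rn.
by rewrite mulr0n.
Qed.

(** Elementary matrices bound the dimensions of the kernel and of the image of a mask from above.
    The bounds add up to the full dimension, so rank-nullity makes them equalities. *)
Lemma dim_suppv S : \dim (suppv S) = #|S|.
Proof.
pose deltas S := <<[seq delta_mx ij.1 ij.2 | ij <- enum S]>>%VS : {vspace 'M[k]_(a, b)}.
have dim_deltas S' : (\dim (deltas S') <= #|S'|)%N.
  by rewrite (leq_trans (dim_span _)) // size_map -cardE.
have mem_deltas S' A : (forall i j, A i j != 0 -> S' (i, j)) -> A \in deltas S'.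
  move=> AS; rewrite [A]matrix_sum_delta rpred_sum // => i _; rewrite rpred_sum // => j _.
  have [->|Aij] := eqVneq (A i j) 0; first by rewrite scale0r rpred0.
  rewrite rpredZ // memv_span //; apply/mapP; exists (i, j) => //.
  by rewrite mem_enum; exact: AS.
have le1 : (\dim (suppv S) <= #|S|)%N.
  rewrite (leq_trans _ (dim_deltas S)) // dimvS //; apply/subvP => A /mem_suppv.
  exact: mem_deltas.
have le2 : (\dim (limg (linfun (mask (predC S)))) <= #|predC S|)%N.
  rewrite (leq_trans _ (dim_deltas _)) // dimvS //; apply/subvP => A /memv_imgP[B _ ->].
  apply: mem_deltas => i j; rewrite lfunE !mxE /=; case: (S _) => //=.
  by rewrite mulr0n eqxx.
have := limg_ker_dim (linfun (mask (predC S))) fullv.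
rewrite capfv -/(suppv S) dimvf => eq_dim.
apply/eqP; rewrite eqn_leq le1 -(leq_add2r #|predC S|) cardC card_prod !card_ord.
apply: leq_trans (_ : _ <= dim 'M[k]_(a, b))%N _; first by rewrite /dim /=.
by rewrite -[in leqLHS]eq_dim leq_add2l.
Qed.

End DegreeSpaces.

(** * The adjoint action of U_q(sl(2)) on End X *)

Section GL2Commutant.
Variables (k : fieldType) (q : k).
Hypotheses (q_neq0 : q != 0) (q_sub : q - q^-1 != 0).
Hypothesis q_gen : forall z : int, q ^ z = 1 -> z = 0.
Variables (M : gmod k) (rM : rels q M).
Local Notation d := (gdim M).
Local Notation E := (gE1 M).
Local Notation F := (gF1 M).
Local Notation K := (gK1 q M).
Local Notation L := (gL1 q M).

Lemma big_deg0 : exists N : nat, forall m (A : 'M[k]_d),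
  gdeg (M := M) m A -> (N < `|m.1|)%N -> A = 0.
Proof.
pose N := \max_i `|(gwt (g := M) i).1|%N; exists (N + N)%N => m A dA Nm.
apply/matrixP => i j; rewrite mxE; apply: contraTeq Nm => /dA/(congr1 fst) /= e.
have wN l : (`|(gwt (g := M) l).1| <= N)%N by rewrite (leq_bigmax l).
by have := wN i; have := wN j; lia.
Qed.

Lemma E1_nilpotent : exists n, E ^+ n = 0.
Proof.
have [N big0] := big_deg0; exists N.+1.
have dE n : gdeg (M := M) ((2 * n)%N%:Z, - n%:Z) (E ^+ n).
  elim: n => [|n IH]; first by rewrite expr0; exact: gdeg1.
  rewrite exprSr; have := has_degM IH (degE1 rM); congr has_deg.
  transitivity ((2 + (2 * n)%N%:Z, -1 - n%:Z) : wt) => //.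
  by congr pair; lia.
by apply: big0 (dE _) _ => /=; lia.
Qed.

(* The adjoint action with respect to the coproduct. On degree zero maps it is
   the commutator up to an invertible factor. *)
Definition adE (f : 'M[k]_d) := E *m f - L *m f *m (K *m E).
Definition adF (f : 'M[k]_d) := (F *m f - f *m F) *m L.

Lemma adE_linear : linear adE.
Proof.
move=> c x y; rewrite /adE !mulmxDr -!scalemxAr !mulmxDl -scalemxAl scalerBr opprD.
by rewrite addrACA.
Qed.
Lemma adF_linear : linear adF.
Proof.
move=> c x y; rewrite /adF mulmxDr [(_ + _) *m F]mulmxDl -scalemxAr -[_ *: x *m F]scalemxAl opprD addrACA.
by rewrite -scalerBr [LHS]mulmxDl -scalemxAl.
Qed.
HB.instance Definition _ :=
  GRing.isLinear.Build k 'M[k]_d 'M[k]_d *:%R adE adE_linear.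
HB.instance Definition _ :=
  GRing.isLinear.Build k 'M[k]_d 'M[k]_d *:%R adF adF_linear.

Let twt j (f : 'M[k]_d) := gdeg (M := M) (j + j, - j) f.

Lemma adE_deg j f : twt j f -> twt (j + 1) (adE f).
Proof.
move=> df; apply: has_degB.
  have := has_degM (degE1 rM) df; congr has_deg.
  transitivity ((j + j + 2, - j - 1) : wt) => //.
  by congr pair; lia.
have dK : gdeg (M := M) 0 K := @gdeg_gdiag _ M _.
have dL : gdeg (M := M) 0 L := @gdeg_gdiag _ M _.
have := has_degM (has_degM dL df) (has_degM dK (degE1 rM)); congr has_deg.
transitivity ((2 + 0 + (j + j + 0), -1 + 0 + (- j + 0)) : wt) => //.
by congr pair; lia.
Qed.

Lemma adF_deg j f : twt j f -> twt (j - 1) (adF f).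
Proof.
move=> df; have dL : gdeg (M := M) 0 L := @gdeg_gdiag _ M _.
have dFf : gdeg (M := M) (j - 1 + (j - 1), - (j - 1)) (F *m f - f *m F).
  apply: has_degB; [have := has_degM (degF1 rM) df|have := has_degM df (degF1 rM)];
    congr has_deg.
    transitivity ((j + j - 2, - j + 1) : wt) => //.
    by congr pair; lia.
  transitivity ((- 2 + (j + j), 1 - j) : wt) => //.
  by congr pair; lia.
by have := has_degM dFf dL; rewrite add0r.
Qed.

Lemma LK : L *m K = 1%:M.
Proof. by rewrite gdiagC (K1L1 q_neq0). Qed.

Lemma adE_adF j f : twt j f ->
  adE (adF f) - adF (adE f) = qbr q (q ^ (j + j)) *: f.
Proof.
move=> df; pose D := gdiag M (fun z => qbr q (q ^ z.1)).
have EF : E *m F = F *m E + D by rewrite /D -(EF11 rM) addrC subrK.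
have KE : K *m E = q ^+ 2 *: (E *m K) := K1_deg q_neq0 (degE1 rM).
have LF : L *m F = q ^+ 2 *: (F *m L) := L1_deg q_neq0 (degF1 rM).
have KF : K *m F = q ^- 2 *: (F *m K) := K1_deg q_neq0 (degF1 rM).
have KL := K1L1 q_neq0 M.
have q2 : q ^+ 2 != 0 by rewrite expf_neq0.
have t1 : adE (adF f) = E *m F *m f *m L - E *m f *m F *m L - L *m F *m f *m E +
    L *m f *m F *m E.
  rewrite /adE /adF !mulmxA (mulmxBr E) !mulmxBl (mulmxBr L) !mulmxBl !mulmxA.
  rewrite -!(mulmxA _ L K) LK !mulmx1; mxlin.
have FLf : F *m L *m f *m K *m E *m L = L *m F *m f *m E.
  rewrite -!mulmxA (mulmxA K) KE -scalemxAl -(mulmxA E) KL mulmx1.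
  by rewrite -!scalemxAr !mulmxA LF -!scalemxAl.
have EFL : L *m f *m K *m E *m F *m L = L *m f *m E *m F.
  rewrite -(mulmxA _ K) KE -scalemxAr -!scalemxAl -!mulmxA (mulmxA K F) KF.
  rewrite -scalemxAl -!mulmxA KL mulmx1 -!scalemxAr scalerA divff //.
  by rewrite scale1r.
have t2 : adF (adE f) = F *m E *m f *m L - L *m F *m f *m E - E *m f *m F *m L +
    L *m f *m E *m F.
  rewrite /adE /adF !mulmxA (mulmxBr F) !mulmxBl !mulmxA FLf EFL; mxlin.
have -> : adE (adF f) - adF (adE f) = D *m f *m L - L *m f *m D.
  have -> : D = E *m F - F *m E by rewrite EF addrC addKr.
  rewrite t1 t2 mulmxBr !mulmxBl !mulmxA; mxlin.
rewrite [D *m f](wdiag_deg _ df) [L *m f](wdiag_deg _ df) -!mulmxA -mulmxBr.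
transitivity (f *m (qbr q (q ^ (j + j)))%:M); last by rewrite mul_mx_scalar.
(* With a the first weight coordinate, the remaining identity is [a + 2j] q^-a - q^-(a + 2j) [a] =
   [2j]. *)
congr (_ *m _); rewrite !wdiagM wdiagB -(wdiag_const (@gwt _ M)).
apply: eq_wdiag => z /=; rewrite /qbr opprD !(expfzDr _ _ q_neq0) -!invr_expz.
rewrite expfzDr //; have := expfz_neq0 z.1 q_neq0; have := expfz_neq0 j q_neq0.
have qq1 := mulqq_sub1 q_neq0 q_sub.
move: (q ^ j) (q ^ z.1) => x y x0 y0; field.
by rewrite q_neq0 qq1 x0 y0.
Qed.

Let adF_nil f : twt 0 f -> exists n, iter n adF f = 0.
Proof.
move=> df; have [N big0] := big_deg0; exists N.+1.
have dn n : twt (- n%:Z) (iter n adF f).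
  elim: n => [|n IH]; first by rewrite oppr0.
  by have := adF_deg IH; rewrite /twt; congr gdeg; congr pair; lia.
by apply: big0 (dn N.+1) _ => /=; lia.
Qed.

Let adE_nil f : twt 1 f -> exists n, iter n adE f = 0.
Proof.
move=> df; have [N big0] := big_deg0; exists N.+1.
have dn n : twt (n%:Z + 1) (iter n adE f).
  elim: n => [|n IH]; first by rewrite add0r.
  by have := adE_deg IH; rewrite /twt; congr gdeg; congr pair; lia.
by apply: big0 (dn N.+1) _ => /=; lia.
Qed.

Lemma adE0 f : twt 0 f -> adE f = E *m f - f *m E.
Proof.
move=> df; rewrite /adE [L *m f](wdiag_deg _ df) -(mulmxA f) (mulmxA _ K).
have -> : wdiag (gwt (g:=M)) (fun z : wt => q ^ (- (z + (0 + 0, - 0)).1)) = L.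
  by apply: eq_wdiag => z; rewrite /= !addr0.
by rewrite LK mul1mx.
Qed.

Lemma ecomm_adE f : ecomm f <-> twt 0 f /\ adE f = 0.
Proof.
split=> [[df fE _]|[df fE]]; first by split=> //; rewrite adE0 // fE subrr.
have fF := sl2_invariant q_neq0 q_sub q_gen adF_deg adE_adF (adF_nil df) df fE.
split=> //; first by apply/eqP; rewrite -subr_eq0 -adE0 // fE.
have := congr1 (mulmx^~ K) fF; rewrite /= /adF -mulmxA LK mulmx1 mul0mx.
by move/eqP; rewrite subr_eq0 => /eqP.
Qed.

Definition degv (m : wt) : {vspace 'M[k]_d} :=
  locked (suppv k [pred ij : 'I_d * 'I_d | gwt ij.1 == gwt ij.2 + m]).

Lemma dim_degv m : \dim (degv m) = 
  #|[pred ij : 'I_d * 'I_d | @gwt _ M ij.1 == @gwt _ M ij.2 + m]|.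
Proof. by rewrite /degv -lock dim_suppv. Qed.

Lemma mem_degv m f : f \in degv m <-> gdeg (M := M) m f.
Proof.
rewrite /degv -lock; split=> [/mem_suppv df i j /df /eqP //|df].
by apply/mem_suppv => i j /df /eqP.
Qed.

Definition ecommv : {vspace 'M[k]_d} := (degv 0%R :&: lker (linfun adE))%VS.

Lemma mem_ecommv f : f \in ecommv <-> ecomm f.
Proof.
rewrite ecomm_adE memv_cap memv_ker lfunE /=; split=> [/andP[df /eqP e]|[df ->]].
  by split=> //; apply/mem_degv.
by rewrite eqxx andbT; apply/mem_degv.
Qed.

(** On degree (2, -1) the composite of [adF] followed by [adE] is injective, hence onto by finite
    dimension, and it passes through degree 0. *)
Lemma adE_img : (linfun adE @: degv 0%R = degv (2, -1)%R)%VS.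
Proof.
apply/eqP; rewrite eqEsubv; apply/andP; split.
  apply/subvP => _ /memv_imgP[f /mem_degv df ->]; rewrite lfunE.
  by apply/mem_degv; exact: (adE_deg (j := 0) df).
set B := degv (2, -1); pose g := (linfun adE \o linfun adF)%VF.
have gB : (g @: B <= B)%VS.
  apply/subvP => _ /memv_imgP[f /mem_degv df ->]; rewrite lfunE /= !lfunE.
  by apply/mem_degv; exact: (adE_deg (j := 0) (adF_deg (j := 1) df)).
have -> : B = (g @: B)%VS.
  symmetry; apply/eqP; rewrite eqEdim gB limg_dim_eq ?leqnn //.
  apply/eqP; rewrite -subv0; apply/subvP => f; rewrite memv_cap memv_ker memv0.
  move=> /andP[/mem_degv df]; rewrite lfunE /= !lfunE => /eqP g0.
  apply/eqP; apply: (sl2_ef_inj q_neq0 q_sub q_gen adE_deg adE_adF (adE_nil df) df g0).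
rewrite limg_comp limgS //; apply/subvP => _ /memv_imgP[f /mem_degv df ->].
by rewrite lfunE; apply/mem_degv; exact: (adF_deg (j := 1) df).
Qed.

Lemma dim_ecommv : (\dim ecommv + \dim (degv (2, -1)%R) = \dim (degv 0%R))%N.
Proof. by rewrite -adE_img limg_ker_dim. Qed.

End GL2Commutant.

(** * Counting weights *)

Section WeightCount.
Local Open Scope nat_scope.

Definition wcount d (w : 'I_d -> wt) (m : wt) : nat :=
  \sum_i \sum_j (w i == (w j + m)%R : nat).

Lemma card_wcount d (w : 'I_d -> wt) m :
  #|[pred ij : 'I_d * 'I_d | w ij.1 == (w ij.2 + m)%R]| = wcount w m.
Proof.
rewrite /wcount -sum1_card big_mkcond pair_bigA /=.
by apply: eq_bigr => ij _; rewrite inE; case: eqP.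
Qed.

Lemma big_tens a b (f : 'I_(a * b) -> nat) :
  \sum_l f l = \sum_i \sum_j f (mxtens_index (i, j)).
Proof.
rewrite pair_bigA /= (reindex (@mxtens_index a b)) /=.
  by apply: eq_bigr => -[i j].
by exists (@mxtens_unindex a b) => l _; rewrite (mxtens_indexK, mxtens_unindexK).
Qed.

Lemma wcount_tens a b (u : 'I_a -> wt) (v : 'I_b -> wt) m :
  wcount (twt u v) m =
  \sum_p \sum_p' wcount u (m + v p' - v p)%R.
Proof.
rewrite /wcount big_tens exchange_big; apply: eq_bigr => p _ /=.
under eq_bigr => i _ do rewrite big_tens exchange_big /=.
rewrite exchange_big; apply: eq_bigr => p' _ /=.
apply: eq_bigr => i _; apply: eq_bigr => j _.
rewrite /twt !mxtens_indexK /=; congr nat_of_bool.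
rewrite -[LHS](inj_eq (addIr (- v p)%R)) addrK.
by congr (_ == _); rewrite !addrA; congr (_ - _)%R; rewrite -!addrA; congr (_ + _)%R; rewrite addrC.
Qed.

(* The coefficient of t^z in (t + 2 + t^-1)^n. *)
Definition cbin (n : nat) (z : int) : nat :=
  if (n%:Z + z)%R is Posz m then 'C(n.*2, m) else 0.

(** Pascal's rule applied twice. The cases n + z = 0 and n + z = -1 are those where some of the
    three neighbours fall off the left end of the row. *)
Lemma cbinS n z : cbin n.+1 z = cbin n (z - 1)%R + (cbin n z).*2 + cbin n (z + 1)%R.
Proof.
rewrite /cbin; case e : (n%:Z + z)%R => [[|t]|[|t]].
- have -> : (n.+1%:Z + z)%R = 1%:Z by lia.
  have -> : (n%:Z + (z - 1))%R = Negz 0 by lia.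
  have -> : (n%:Z + (z + 1))%R = 1%:Z by lia.
  by rewrite doubleS !bin1 bin0; lia.
- have -> : (n.+1%:Z + z)%R = t.+2%:Z by lia.
  have -> : (n%:Z + (z - 1))%R = t%:Z by lia.
  have -> : (n%:Z + (z + 1))%R = t.+2%:Z by lia.
  by rewrite doubleS !binS; lia.
- have -> : (n.+1%:Z + z)%R = 0%:Z by lia.
  have -> : (n%:Z + (z - 1))%R = Negz 1 by lia.
  have -> : (n%:Z + (z + 1))%R = 0%:Z by lia.
  by rewrite !bin0.
- have -> : (n.+1%:Z + z)%R = Negz t by lia.
  have -> : (n%:Z + (z - 1))%R = Negz t.+2 by lia.
  have -> : (n%:Z + (z + 1))%R = Negz t by lia.
  by [].
Qed.

(** In the coordinates (z.1 + z.2, z.2) the weights of V are the four points of {0, 1}^2, with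
    character (1 + s) (1 + t). Differences of weights thus have generating function (s + 2 + s^-1)
    (t + 2 + t^-1), and the count for the n-th power factors. *)
Lemma wcount_gpow (k : fieldType) (q kap s : k) n (x y : int) :
  wcount (@gwt _ (gpow q kap s n)) (x - y, y)%R = cbin n x * cbin n y.
Proof.
elim: n x y => [|n IH] x y.
  have cbin0 z : cbin 0 z = (z == 0%R) by case: z => [[|z]|z].
  rewrite /wcount !big_ord_recl !big_ord0 /= !addn0 add0r xpair_eqE !cbin0 mulnb.
  by congr nat_of_bool; apply/idP/idP; lia.
have IHm (m : wt) : wcount (@gwt _ (gpow q kap s n)) m =
    cbin n (m.1 + m.2)%R * cbin n m.2.
  by case: m => a b; rewrite -IH addrK.
rewrite wcount_tens !big_ord_recl !big_ord0 -/(gpow q kap s n) !IHm /= !cbinS.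
have [c ec] : exists c, c =1 cbin n by exists (cbin n).
rewrite -!ec.
have e0 z u : z = u -> c z = c u by move->.
repeat match goal with |- context [c ?z] =>
  first [ progress rewrite (e0 z x); last lia
        | progress rewrite (e0 z (x - 1)%R); last lia
        | progress rewrite (e0 z (x + 1)%R); last lia
        | progress rewrite (e0 z y); last lia
        | progress rewrite (e0 z (y - 1)%R); last lia
        | progress rewrite (e0 z (y + 1)%R); last lia ] end.
rewrite -!muln2 !addn0; ring.
Qed.

Lemma cbin_central n : cbin n 0 = 'C(n.*2, n).
Proof. by rewrite /cbin addr0. Qed.

Lemma cbin_pos n : cbin n 1 * n.+1 = 'C(n.*2, n) * n.
Proof.
rewrite /cbin (_ : (n%:Z + 1)%R = n.+1%:Z); last by lia.
by rewrite mulnC mul_bin_left -addnn addnK mulnC.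
Qed.

Lemma cbin_neg n : cbin n (-1)%R * n.+1 = 'C(n.*2, n) * n.
Proof.
case: n => [|n]; first by rewrite muln0.
rewrite /cbin (_ : (n.+1%:Z + -1)%R = n%:Z); last by lia.
by rewrite [RHS]mulnC mul_bin_left mulnC; congr (_ * _); lia.
Qed.

(** Multiplying by (n+1)^2 turns each off-central coefficient into n times the central one, so D
    (n+1)^2 is the squared central coefficient times (n+1)^2 - n^2 = 2n + 1. *)
Lemma dim_formula n D : D + cbin n 1 * cbin n (-1)%R = cbin n 0 * cbin n 0 ->
  D * (n`! * (n.+1)`!) ^ 2 = (2 * n)`! * (2 * n + 1)`!.
Proof.
move=> eD; rewrite addn1 factS mul2n factS.
have eC : 'C(n.*2, n) * (n`! * n`!) = (n.*2)`!.
  by have := @bin_fact n.*2 n; rewrite -addnn addnK leq_addr => ->.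
have eD2 : D * n.+1 ^ 2 = 'C(n.*2, n) ^ 2 * n.*2.+1.
  have := congr1 (muln^~ (n.+1 ^ 2)) eD; rewrite /= mulnDl.
  have -> : cbin n 1 * cbin n (-1)%R * n.+1 ^ 2 =
      (cbin n 1 * n.+1) * (cbin n (-1)%R * n.+1) by ring.
  rewrite cbin_pos cbin_neg cbin_central.
  move: 'C(_, _) => C; rewrite -!mul2n => e.
  by apply/eqP; rewrite -(eqn_add2r (C * n * (C * n))) e; apply/eqP; ring.
rewrite -eC; transitivity ((D * n.+1 ^ 2) * (n`!) ^ 4); first by ring.
by rewrite eD2; ring.
Qed.

Lemma dim_ecommv_gpow (k : fieldType) (q kap s : k) n :
  q != 0%R -> (q - q^-1)%R != 0%R -> (forall z : int, (q ^ z)%R = 1%R -> z = 0%R) ->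
  kap != 0%R -> (s * s)%R = 1%R ->
  \dim (ecommv q (gpow q kap s n)) * (n`! * (n.+1)`!) ^ 2 =
  (2 * n)`! * (2 * n + 1)`!.
Proof.
move=> q0 qs qg kap0 ss; have rM := rels_gpow q0 qs kap0 ss n.
apply: dim_formula; have := dim_ecommv q0 qs qg rM.
rewrite !dim_degv !card_wcount.
(* The degree (2, -1) of E1 corresponds to x = 1 and y = -1. *)
have := wcount_gpow q kap s n 1 (-1)%R; rewrite /= => ->.
by have := wcount_gpow q kap s n 0 0; rewrite subr0 => ->.
Qed.

End WeightCount.

(** * Powers of q and the operator q^h *)

Section QPowers.
Variable R : realType.
Local Notation C := (R[i]).
Local Notation k := (laurent R).
Local Notation q := (q R).

Lemma cstD (x y : C) : cst (x + y) = cst x + cst y.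
Proof.
rewrite /cst -rmorphD; congr FracField.tofrac; apply/funext => -[|n] //=.
by rewrite /GRing.add /= /fps_add /fpsC /= addr0.
Qed.

Lemma cstN (x : C) : cst (- x) = - cst x.
Proof.
rewrite /cst -rmorphN; congr FracField.tofrac; apply/funext => -[|n] //=.
by rewrite /GRing.opp /= /fps_opp /fpsC /= oppr0.
Qed.

Lemma cst1 : cst (1 : C) = 1.
Proof. by rewrite /cst -(rmorph1 (@FracField.tofrac (fps C))). Qed.

Lemma cst0 : cst (0 : C) = 0.
Proof. by apply: (addIr (cst 0)); rewrite -cstD !add0r. Qed.

Lemma cst_int (m : int) : cst (m%:~R : C) = m%:~R.
Proof.
have cstn (n : nat) : cst (n%:R : C) = n%:R.
  elim: n => [|n IH]; first exact: cst0.
  by rewrite -!natr1 cstD IH cst1.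
by case: m => n; rewrite ?NegzE ?mulrNz ?cstN -!pmulrn cstn.
Qed.

Lemma cst_inj : injective (@cst R).
Proof.
move=> x y /eqP; rewrite /cst tofrac_eq => /eqP/(congr1 (fun f => f 0%N)).
by [].
Qed.

Lemma qpowD (x y : C) : qpow (x + y) = qpow x * qpow y.
Proof.
rewrite /qpow -rmorphM; congr FracField.tofrac; apply/funext => n.
have fpsM (f g : fps C) : (f * g) n = \sum_(i < n.+1) f i * g (n - i)%N by [].
rewrite fpsM mulrDl addrC exprDn mulr_suml.
apply: eq_bigr => i _.
have ni : (i <= n)%N by rewrite -ltnS.
have := bin_fact ni => /(congr1 (fun n => n%:R : C)); rewrite !natrM => e.
have nz m : (m`!%:R : C) != 0 by rewrite pnatr_eq0 -lt0n fact_gt0.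
have := nz n; have := nz i; have := nz (n - i)%N; rewrite -e mulrnAl.
rewrite -(mulr_natr _ 'C(n, i)).
move: ((x / 2) ^+ i) ((y / 2) ^+ (n - i)) => X Y n1 n2 n3.
by field; rewrite n1 n2; move: n3; rewrite mul1r mulf_eq0 negb_or => /andP[].
Qed.

Lemma qpow0 : qpow (0 : C) = 1.
Proof.
rewrite /qpow -(rmorph1 (@FracField.tofrac (fps C))); congr FracField.tofrac.
apply/funext => -[|n]; rewrite mul0r ?expr0 ?divr1 ?exprS ?mul0r //.
Qed.

Lemma qpow_neq0 (x : C) : qpow x != 0.
Proof.
apply/eqP => e; have := qpowD x (- x); rewrite subrr qpow0 e mul0r.
by move/eqP; rewrite oner_eq0.
Qed.

Lemma qpowN (x : C) : qpow (- x) = (qpow x)^-1.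
Proof.
by apply: (mulfI (qpow_neq0 x)); rewrite -qpowD subrr qpow0 divff ?qpow_neq0.
Qed.

Lemma qpow_int (m : int) : qpow (m%:~R : C) = q ^ m.
Proof.
have qpown (n : nat) : qpow (n%:R : C) = q ^ n.
  elim: n => [|n IH]; first exact: qpow0.
  by rewrite -natr1 qpowD IH -!exprnP exprSr.
by case: m => n; rewrite ?NegzE ?mulrNz ?qpowN -!pmulrn qpown // -exprnN.
Qed.

(** The coefficient of hbar in q^x is x / 2. *)
Lemma qpow_eq1 (x : C) : qpow x = 1 -> x = 0.
Proof.
rewrite /qpow -(rmorph1 (@FracField.tofrac (fps C))) => /eqP.
rewrite tofrac_eq => /eqP/(congr1 (fun f => f 1%N)) /=.
rewrite expr1 divr1 => /eqP; rewrite mulf_eq0 invr_eq0 pnatr_eq0 orbF => /eqP.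
by [].
Qed.

Lemma q_neq0 : q != 0. Proof. exact: qpow_neq0. Qed.

Lemma q_gen (z : int) : q ^ z = 1 -> z = 0.
Proof. by rewrite -qpow_int => /qpow_eq1/eqP; rewrite intr_eq0 => /eqP. Qed.

Lemma q_sub : q - q^-1 != 0.
Proof.
apply/eqP => /(congr1 (fun x => x * q)) /eqP; rewrite mul0r mulrBl mulVf ?q_neq0 //.
by rewrite subr_eq0 => /eqP e; have /q_gen : q ^ 2 = 1 by [].
Qed.

Lemma q_add : q + q^-1 != 0.
Proof.
apply/eqP => /(congr1 (fun x => x * q)) /eqP; rewrite mul0r mulrDl mulVf ?q_neq0 //.
rewrite addr_eq0 => /eqP e.
have /q_gen // : q ^ (2 + 2) = 1.
by rewrite expfzDr ?q_neq0 // (e : q ^ 2 = -1) mulrNN mulr1.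
Qed.

Lemma qbr_qpow (x : C) : qbr q (qpow x) = (q - q^-1)^-1 * (qpow x - qpow (- x)).
Proof. by rewrite qpowN mulrC. Qed.

Lemma qbr_qpow_neq0 (x : C) : x != 0 -> qbr q (qpow x) != 0.
Proof.
move=> x0; rewrite /qbr mulf_neq0 ?invr_eq0 ?q_sub // -qpowN subr_eq0.
apply: contra_neq x0 => e; have : qpow (x + x) = 1.
  by rewrite qpowD {1}e -qpowD addNr qpow0.
by move/qpow_eq1/eqP; rewrite -mulr2n mulrn_eq0 => /eqP.
Qed.

Section QExp.
Variables (d e : nat) (h : 'M[k]_d) (B : 'M[k]_(d, e)) (B' : 'M[k]_(e, d)).
Variable z : 'I_e -> C.
Hypotheses (BB' : B *m B' = 1%:M) (B'B : B' *m B = 1%:M).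
Hypothesis hB : h *m B = B *m diag_mx (\row_j cst (z j)).

Lemma qexp_eigen (x : C) (v : 'cV[k]_d) :
  h *m v = cst x *: v -> qexp h *m v = qpow x *: v.
Proof.
have ex : exists K : 'M[k]_d, forall (x : C) (v : 'cV[k]_d),
    h *m v = cst x *: v -> K *m v = qpow x *: v; last exact: (xgetPex 0 ex).
(* This operator scales the j-th basis vector by q^(z j). An eigenvector for x involves only basis
   vectors with z j = x, because [cst] is injective. *)
exists (B *m diag_mx (\row_j qpow (z j)) *m B') => {}x {}v /= hv.
have {hv} : diag_mx (\row_j cst (z j)) *m (B' *m v) = cst x *: (B' *m v).
  rewrite -[diag_mx _]mul1mx -B'B -(mulmxA B') -hB -!mulmxA (mulmxA B B') BB'.
  by rewrite mul1mx hv -scalemxAr.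
move=> hv; transitivity (B *m (qpow x *: (B' *m v))); last first.
  by rewrite -scalemxAr mulmxA BB' mul1mx.
rewrite -!mulmxA; congr (_ *m _).
apply/colP => i; have /colP/(_ i) := hv.
rewrite !mul_diag_mx !mxE => /eqP.
rewrite -subr_eq0 -mulrBl mulf_eq0 subr_eq0 => /orP[/eqP/cst_inj -> //|/eqP ->].
by rewrite !mulr0.
Qed.

Lemma qexpE : qexp h *m B = B *m diag_mx (\row_j qpow (z j)).
Proof.
have colB j : col j (B *m diag_mx (\row_j cst (z j))) = cst (z j) *: col j B.
  by apply/colP => i; rewrite mul_mx_diag !mxE mulrC.
apply/matrixP => i j.
have := @qexp_eigen (z j) (col j B); rewrite -colB -hB !colE -mulmxA => /(_ erefl).
move/colP/(_ i); rewrite mulmxA -!colE mxE => ->.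
by rewrite mul_mx_diag !mxE mulrC.
Qed.

End QExp.

End QPowers.

(** * Realizations *)

Section SuperCommutator.
Variables (k : fieldType) (d : nat) (p : 'I_d -> bool).
Implicit Types x y : 'M[k]_d.
Local Notation P := (@parity_mx k d p).

Lemma hpart_sum x : hpart p false x + hpart p true x = x.
Proof.
apply/matrixP => i j; rewrite !mxE.
by case: (_ (+) _); rewrite /= ?add0r ?addr0.
Qed.

Lemma hpart_homogeneous b b' x : homogeneous p b x ->
  hpart p b' x = if b' == b then x else 0.
Proof.
move=> hx; case: eqP => [-> //|nb]; rewrite -hx; apply/matrixP => i j; rewrite !mxE.
by case: eqP => // e1; case: eqP => // e2; case: nb; rewrite -e1 -e2.
Qed.

Lemma scomm_even_r x y : homogeneous p false y -> scomm p x y = x *m y - y *m x.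
Proof.
move=> hy; rewrite /scomm !big_bool !(hpart_homogeneous _ hy) /=.
rewrite !(mulmx0, mul0mx, scaler0, subr0, add0r) /= !expr0 !scale1r.
rewrite -[in RHS](hpart_sum x) mulmxDl mulmxDr; mxlin.
Qed.

Lemma scomm_even_l x y : homogeneous p false x -> scomm p x y = x *m y - y *m x.
Proof.
move=> hx; rewrite /scomm !big_bool !(hpart_homogeneous _ hx) /=.
rewrite !(mulmx0, mul0mx, scaler0, subr0, add0r) /= !expr0 !scale1r.
rewrite -[in RHS](hpart_sum y) mulmxDl mulmxDr; mxlin.
Qed.

Lemma scomm_homogeneous a b x y : homogeneous p a x -> homogeneous p b y ->
  scomm p x y = x *m y - (-1) ^+ (a && b) *: (y *m x).
Proof.
move=> hx hy; rewrite /scomm !big_bool !(hpart_homogeneous _ hy) !(hpart_homogeneous _ hx).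
case: a hx; case: b hy => /= hy hx;
  rewrite ?(mulmx0, mul0mx, scaler0, subr0, sub0r, oppr0, add0r, addr0) //.
Qed.

Lemma parity_mxE : P = diag_mx (\row_j (-1) ^+ p j).
Proof. by apply/matrixP => i j; rewrite !mxE; case: eqP => [->|]. Qed.

Lemma homogeneous_parity b x : homogeneous p b x -> P *m x = (-1) ^+ b *: (x *m P).
Proof.
move=> hx; rewrite parity_mxE mul_diag_mx mul_mx_diag; apply/matrixP => i j.
rewrite !mxE -hx !mxE; case: eqP => [<-|_]; last by rewrite !(mulr0, mul0r).
by case: (p i); case: (p j); rewrite /= ?expr0 ?expr1; ring.
Qed.

Lemma parity_homogeneous x : (2%:R : k) != 0 -> P *m x = x *m P -> homogeneous p false x.
Proof.
move=> two; rewrite parity_mxE mul_diag_mx mul_mx_diag => /matrixP e.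
apply/matrixP => i j; have := e i j; rewrite !mxE.
case: (p i); case: (p j) => //=; rewrite ?expr0 ?expr1 ?mulN1r ?mulrN1 ?mul1r ?mulr1.
  by move=> /eqP; rewrite eq_sym -addr_eq0 -mulr2n -mulr_natl mulf_eq0 (negPf two) => /eqP ->.
by move=> /eqP; rewrite -addr_eq0 -mulr2n -mulr_natl mulf_eq0 (negPf two) => /eqP ->.
Qed.

Lemma parity_mxK : P *m P = 1%:M.
Proof.
rewrite parity_mxE mul_diag_mx; apply/matrixP => i j; rewrite !mxE.
by case: eqP => [->|_]; rewrite ?mulr0n ?mulr0 // !mulr1n; case: (p j); rewrite ?mulr1 ?mulrNN ?mulr1.
Qed.

End SuperCommutator.

Section Realizations.
Variable R : realType.
Local Notation C := (R[i]).
Local Notation k := (laurent R).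
Local Notation q := (q R).

Lemma two_neq0 : (2%:R : k) != 0.
Proof.
have -> : (2%:R : k) = cst (2%:R : C) := esym (cst_int R 2).
by rewrite -(cst0 R) (inj_eq (@cst_inj R)) pnatr_eq0.
Qed.

Definition hdiag (M : gmod k) (c0 : C) (i : 'I_2) : 'M[k]_(gdim M) :=
  diag_mx (\row_j cst (if i == ord0 then (gwt j).1%:~R else c0 + (gwt j).2%:~R)).

(** B is a basis of W in which the generators take the form given by M, and c0 is the complex offset
    of the h2-weights. Keeping the inverse B' as data avoids any identification of [udim W] with
    [gdim M]. *)
Record realizes (W : uqdata k) (M : gmod k) (c0 : C)
    (B : 'M[k]_(udim W, gdim M)) (B' : 'M[k]_(gdim M, udim W)) : Prop := Realizes {
  r_BB' : B *m B' = 1%:M;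
  r_B'B : B' *m B = 1%:M;
  r_c : gc M = qpow c0;
  r_P : parity_mx k (@upar _ W) *m B = B *m gP M;
  r_E1 : uE W ord0 *m B = B *m gE1 M;
  r_E2 : uE W ord_max *m B = B *m gE2 M;
  r_F1 : uF W ord0 *m B = B *m gF1 M;
  r_F2 : uF W ord_max *m B = B *m gF2 M;
  r_h : forall i, uh W i *m B = B *m hdiag M c0 i }.

Section OneRealization.
Variables (W : uqdata k) (M : gmod k) (c0 : C).
Variables (B : 'M[k]_(udim W, gdim M)) (B' : 'M[k]_(gdim M, udim W)).
Hypothesis rW : realizes c0 B B'.

Let opp_diag e (z : 'I_e -> C) : - diag_mx (\row_j cst (z j)) = diag_mx (\row_j cst (- z j)).
Proof. by apply/matrixP => i j; rewrite !mxE cstN mulNrn. Qed.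

Lemma qexp_uh1 : qexp (uh W ord0) *m B = B *m gK1 q M.
Proof.
rewrite (qexpE (r_BB' rW) (r_B'B rW) (r_h rW ord0)); congr (_ *m diag_mx _).
by apply/rowP => j; rewrite !mxE qpow_int.
Qed.

Lemma qexp_uh2 : qexp (uh W ord_max) *m B = B *m gK2 q M.
Proof.
rewrite (qexpE (r_BB' rW) (r_B'B rW) (r_h rW ord_max)); congr (_ *m diag_mx _).
by apply/rowP => j; rewrite !mxE qpowD qpow_int (r_c rW).
Qed.

Lemma qexp_Nuh1 : qexp (- uh W ord0) *m B = B *m gL1 q M.
Proof.
have e := r_h rW ord0; rewrite (qexpE (r_BB' rW) (r_B'B rW) (z := fun j => - (gwt j).1%:~R)).
  by congr (_ *m diag_mx _); apply/rowP => j; rewrite !mxE -mulrNz qpow_int.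
by rewrite mulNmx e -mulmxN opp_diag.
Qed.

Lemma qexp_Nuh2 : qexp (- uh W ord_max) *m B = B *m gL2 q M.
Proof.
have e := r_h rW ord_max.
rewrite (qexpE (r_BB' rW) (r_B'B rW) (z := fun j => - (c0 + (gwt j).2%:~R))).
  congr (_ *m diag_mx _); apply/rowP => j.
  by rewrite !mxE opprD qpowD qpowN -mulrNz qpow_int (r_c rW).
by rewrite mulNmx e -mulmxN opp_diag.
Qed.

End OneRealization.

Lemma realizes_tens W V M S cW cV B B' D D' :
  @realizes W M cW B B' -> @realizes V S cV D D' ->
  @realizes (uq_tens W V) (gtens q M S) (cW + cV) (B *t D) (B' *t D').
Proof.
move=> rW rV; have PW := r_P rW.
split.
- by rewrite tensmx_mul (r_BB' rW) (r_BB' rV) tensmx11.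
- by rewrite tensmx_mul (r_B'B rW) (r_B'B rV) tensmx11.
- by rewrite /= (r_c rW) (r_c rV) qpowD.
- have -> : parity_mx k (@upar _ (uq_tens W V)) =
      parity_mx k (@upar _ W) *t parity_mx k (@upar _ V).
    apply/matrixP => i j; case: (mxtens_indexP i) => i0 i1; case: (mxtens_indexP j) => j0 j1.
    rewrite tensmxE !mxE (can_eq (@mxtens_indexK _ _)) xpair_eqE.
    have up a b : @upar _ (uq_tens W V) (mxtens_index (a, b)) = upar a (+) upar b.
      rewrite -[LHS]/(upar (mxtens_unindex (mxtens_index (a, b))).1 (+)
        upar (mxtens_unindex (mxtens_index (a, b))).2).
      by rewrite mxtens_indexK.
    rewrite up signr_addb; case: eqP; case: eqP => //= _ _;
    by rewrite ?mulr0n ?mulr1n ?mulr0 ?mul0r.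
  by rewrite gP_tens !tensmx_mul (r_P rW) (r_P rV).
- rewrite /= /stens /= mulmx1 mulmxDl mulmxDr !tensmx_mul !mul1mx !mulmx1.
  by rewrite (r_E1 rW) (r_E1 rV) (qexp_Nuh1 rW).
- rewrite /= /stens /= mulmx1 mulmxDl mulmxDr !tensmx_mul !mul1mx !mulmx1.
  by rewrite (r_E2 rW) (r_E2 rV) -mulmxA PW mulmxA (qexp_Nuh2 rW) -!mulmxA.
- rewrite /= /stens /= !mulmx1 mulmxDl mulmxDr !tensmx_mul !mul1mx !mulmx1.
  by rewrite (r_F1 rW) (r_F1 rV) (qexp_uh1 rV).
- rewrite /= /stens /= !mulmx1 mul1mx mulmxDl mulmxDr !tensmx_mul.
  by rewrite (r_F2 rW) (r_F2 rV) PW (qexp_uh2 rV).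
- move=> i; rewrite /= /stens /= !mulmx1 mulmxDl !tensmx_mul !mul1mx.
  rewrite (r_h rW) (r_h rV).
  have -> : hdiag (gtens q M S) (cW + cV) i = hdiag M cW i *t 1%:M + 1%:M *t hdiag S cV i.
    apply/matrixP => a b.
    case: (mxtens_indexP a) => a0 a1; case: (mxtens_indexP b) => b0 b1.
    rewrite addmxE !tensmxE !mxE (can_eq (@mxtens_indexK _ _)) xpair_eqE.
    have tw x y : @gwt _ (gtens q M S) (mxtens_index (x, y)) = gwt x + gwt y.
      by rewrite -[LHS]/(twt (@gwt _ M) (@gwt _ S) _) /twt mxtens_indexK.
    rewrite tw.
    have [->|na] := eqVneq a0 b0; have [->|nb] := eqVneq a1 b1;
      rewrite /= ?(mulr0n, mulr1n, mulr0, mul0r, mulr1, mul1r, addr0) //.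
    by rewrite -cstD; congr cst; case: ifP => _; rewrite intrD //; ring.
  by rewrite mulmxDr !tensmx_mul !mulmx1.
Qed.

End Realizations.

(** * Transport of endomorphisms along a change of basis *)

Lemma sandwichK (k : fieldType) m n (B : 'M[k]_(m, n)) (B' : 'M[k]_(n, m)) (X : 'M[k]_n) :
  B' *m B = 1%:M -> B' *m (B *m X *m B') *m B = X.
Proof. by move=> B'B; rewrite !mulmxA B'B mul1mx -mulmxA B'B mulmx1. Qed.

Lemma mulmx_conj_comm (k : fieldType) d e (B : 'M[k]_(d, e)) (B' : 'M[k]_(e, d))
    (X : 'M[k]_d) (Y : 'M[k]_e) (f : 'M[k]_d) :
  B *m B' = 1%:M -> B' *m B = 1%:M -> X *m B = B *m Y ->
  X *m f = f *m X <-> Y *m (B' *m f *m B) = B' *m f *m B *m Y.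
Proof.
move=> BB' B'B XB; have B'X : B' *m X = Y *m B'.
  by rewrite -[B' *m X]mulmx1 -BB' mulmxA -(mulmxA B' X) XB mulmxA B'B mul1mx.
split=> [Xf|e1].
  by rewrite !mulmxA -B'X -!mulmxA -XB (mulmxA X) Xf -!mulmxA.
have : B *m (Y *m (B' *m f *m B)) *m B' = B *m (B' *m f *m B *m Y) *m B' by rewrite e1.
rewrite !mulmxA -XB -!mulmxA (mulmxA B B') BB' mul1mx mulmx1.
by rewrite -B'X !(mulmxA B B') BB' !mul1mx.
Qed.

Section Endomorphisms.
Variable R : realType.
Local Notation C := (R[i]).
Local Notation k := (laurent R).
Local Notation q := (q R).

Lemma ord2P (Q : 'I_2 -> Prop) : Q ord0 -> Q ord_max -> forall i, Q i.
Proof.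
move=> Q0 Q1 [[|[|//]] lt]; first by rewrite (_ : Ordinal lt = ord0) //; apply: val_inj.
by rewrite (_ : Ordinal lt = ord_max) //; apply: val_inj.
Qed.

Section Realized.
Variables (W : uqdata k) (M : gmod k) (c0 : C).
Variables (B : 'M[k]_(udim W, gdim M)) (B' : 'M[k]_(gdim M, udim W)).
Hypothesis rW : realizes c0 B B'.

Let conj_comm X Y f (XB : X *m B = B *m Y) :=
  mulmx_conj_comm f (r_BB' rW) (r_B'B rW) XB.

Lemma hdiag_deg0 (f : 'M[k]_(gdim M)) :
  (forall i, hdiag M c0 i *m f = f *m hdiag M c0 i) -> gdeg (M := M) 0 f.
Proof.
move=> hf i j fij; rewrite addr0.
have eq_h (l : 'I_2) : cst (if l == ord0 then (gwt i).1%:~R else c0 + (gwt i).2%:~R) =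
              cst (if l == ord0 then (gwt j).1%:~R else c0 + (gwt j).2%:~R) :> k.
  have /matrixP/(_ i j) := hf l; rewrite mul_diag_mx mul_mx_diag !mxE mulrC.
  exact: mulfI.
have /cst_inj/intr_inj e1 := eq_h ord0.
have /cst_inj/addrI/intr_inj e2 := eq_h ord_max.
by rewrite [LHS]surjective_pairing e1 e2 -surjective_pairing.
Qed.

(** The h_i are even, so supercommuting with them is commuting and forces degree 0. Parity being a
    function of the weight, f is then even, and the other supercommutators become commutators as
    well. *)
Lemma uq_End_gcomm (f : 'M[k]_(udim W)) :
  f \in uq_End W <-> gcomm (L := M) (B' *m f *m B).
Proof.
have hP i : homogeneous (@upar _ W) false (uh W i).
  apply: parity_homogeneous; first exact: two_neq0.
  have hE : B' *m uh W i *m B = hdiag M c0 i.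
    by rewrite -mulmxA (r_h rW) mulmxA (r_B'B rW) mul1mx.
  apply/(conj_comm _ (r_P rW)); rewrite hE /gP /gdiag /wdiag !mulmx_diag; congr diag_mx.
  by apply/rowP => j; rewrite !mxE mulrC.
have scomm_h i g : scomm (@upar _ W) (uh W i) g = uh W i *m g - g *m uh W i.
  by rewrite (scomm_even_l _ (hP i)).
have f_even : (forall h, gdiag M h *m (B' *m f *m B) = B' *m f *m B *m gdiag M h) ->
    homogeneous (@upar _ W) false f.
  move=> fC; apply: parity_homogeneous; first exact: two_neq0.
  by apply/(conj_comm _ (r_P rW)); exact: fC.
split=> [/mem_uq_End fW | [df [fE1 fE2 fF1 fF2]]].
  have df : gdeg (M := M) 0 (B' *m f *m B).
    apply: hdiag_deg0 => i; apply/(conj_comm _ (r_h rW i)).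
    by have [_ _ /eqP] := fW i; rewrite scomm_h subr_eq0 => /eqP.
  have fe := f_even (iffLR (deg0_diag _) df).
  split=> //; have [E1 F1 _] := fW ord0; have [E2 F2 _] := fW ord_max.
  rewrite !(scomm_even_r _ fe) in E1 F1 E2 F2.
  split.
  - by apply/(conj_comm _ (r_E1 rW)); exact: subr0_eq E1.
  - by apply/(conj_comm _ (r_E2 rW)); exact: subr0_eq E2.
  - by apply/(conj_comm _ (r_F1 rW)); exact: subr0_eq F1.
  - by apply/(conj_comm _ (r_F2 rW)); exact: subr0_eq F2.
have fC := iffLR (deg0_diag _) df.
have hC i : uh W i *m f = f *m uh W i.
  apply/(conj_comm _ (r_h rW i)).
  exact: (fC (fun z => cst (if i == ord0 then z.1%:~R else c0 + z.2%:~R))).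
have fe := f_even fC.
apply/mem_uq_End; apply: ord2P; rewrite !(scomm_even_r _ fe).
  split; apply/eqP; rewrite subr_eq0; apply/eqP.
  - exact/(conj_comm _ (r_E1 rW)).
  - exact/(conj_comm _ (r_F1 rW)).
  - exact: hC.
split; apply/eqP; rewrite subr_eq0; apply/eqP.
- exact/(conj_comm _ (r_E2 rW)).
- exact/(conj_comm _ (r_F2 rW)).
- exact: hC.
Qed.

End Realized.

Section Conjugate.
Variables (W : uqdata k) (M N : gmod k).
Variables (iota : 'M[k]_(gdim N, gdim M)).
Variables (inj : 'I_4 -> 'M[k]_(gdim N, gdim M)) (prj : 'I_4 -> 'M[k]_(gdim M, gdim N)).
Variables (B : 'M[k]_(udim W, gdim N)) (B' : 'M[k]_(gdim N, udim W)).

Definition conj_induced (g : 'M[k]_(gdim M)) : 'M[k]_(udim W) :=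
  B *m induced_map iota inj prj g *m B'.

Lemma conj_induced_is_linear : linear conj_induced.
Proof.
move=> c x y; rewrite /conj_induced induced_map_is_linear mulmxDr mulmxDl.
by rewrite -scalemxAr -scalemxAl.
Qed.
HB.instance Definition _ := GRing.isLinear.Build k 'M[k]_(gdim M) 'M[k]_(udim W)
  *:%R conj_induced conj_induced_is_linear.

End Conjugate.

Section Dimension.
Variables (alpha : C) (s : k) (n : nat).
Hypothesis irr : forall r : rat, alpha <> ratr r.
Hypothesis s_sqr : s * s = 1.
Local Notation M := (gpow q (qpow alpha) s n).
Local Notation S := (gstd q (qpow alpha) s).
Local Notation N := (gtens q M S).

Lemma irr_neq0 (m : nat) (z : int) : m.+1%:R * alpha + z%:~R != 0.
Proof.
apply/eqP => /eqP; rewrite addr_eq0 => /eqP e.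
apply: (irr (r := - z%:~R / m.+1%:R)).
rewrite fmorph_div rmorphN /= ratr_int ratr_nat -e mulrAC divff ?mul1r //.
by rewrite pnatr_eq0.
Qed.

Lemma gc_gpow m : gc (gpow q (qpow alpha) s m) = qpow (m%:R * alpha).
Proof.
elim: m => [|m IH] /=; first by rewrite mul0r qpow0.
by rewrite IH -qpowD -natr1 mulrDl mul1r.
Qed.

(** The h2-weights of W lie in (n+1) alpha + Z, which avoids 0 as alpha is irrational. *)
Lemma typical (z : int) : qbr q (gc N * q ^ z) != 0.
Proof.
rewrite /= gc_gpow -qpowD -qpow_int -qpowD qbr_qpow_neq0 //.
by rewrite -{2}[alpha]mul1r -mulrDl natr1 irr_neq0.
Qed.

Lemma dim_uq_End (W : uqdata k) c0 (B : 'M[k]_(udim W, gdim N)) B' :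
  realizes c0 B B' -> \dim (uq_End W) = \dim (ecommv q M).
Proof.
move=> rW; have q0 := q_neq0 R; have qs := q_sub R; have qa := q_add R.
have kap0 := qpow_neq0 alpha.
have rM : rels q M := rels_gpow q0 qs kap0 s_sqr n.
have rN : rels q N := rels_gpow q0 qs kap0 s_sqr n.+1.
have kb : qbr q (qpow alpha) != 0.
  by rewrite qbr_qpow_neq0 //; have := irr_neq0 0 0; rewrite mul1r addr0.
have kqb : qbr q (qpow alpha * q) != 0.
  by rewrite -qpowD qbr_qpow_neq0 //; have := irr_neq0 0 1; rewrite mul1r.
pose iota := iota_mx q (qpow alpha) s M.
have iE1 := iotaE1 q0 qs qa kap0 s_sqr rM.
have iF1 := iotaF1 q0 qs kap0 s_sqr rM.
have iE2 := iotaE2 q0 qs kap0 s_sqr rM.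
have idg := iota_deg q0 qs kap0 s_sqr rM.
have iinj := @iota_inj _ _ _ s q0 _ rM kb kqb.
have iTp : exists a, iota = Tp N *m a.
  by exists (inj_mx k _ (lift ord0 (lift ord0 (lift ord0 ord0)) : 'I_4)); rewrite /iota /iota_mx -lock.
have pi := @prj_inj k (gdim M) 4; have sip := @sum_inj_prj k (gdim M) 4.
have E1n := E1_nilpotent q0 qs rM.
pose Phi := conj_induced iota (@inj_mx k (gdim M) 4) (@prj_mx k (gdim M) 4) B B'.
have PhiE g : B' *m Phi g *m B = induced_map iota (@inj_mx k (gdim M) 4) (@prj_mx k (gdim M) 4) g.
  exact: sandwichK (r_B'B rW).
have -> : uq_End W = (linfun Phi @: ecommv q M)%VS.
  apply/eqP; rewrite eqEsubv; apply/andP; split; apply/subvP => f.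
    move/(uq_End_gcomm rW)/(gcomm_induced_map q0 qs qa rM rN iE1 iF1 iE2 idg iinj iTp pi sip E1n typical).
    case=> g cg fE; apply/memv_imgP; exists g; last first.
      by rewrite lfunE /= /conj_induced -fE (sandwichK _ (r_BB' rW)).
    by apply/(mem_ecommv q0 qs (@q_gen R) rM).
  case/memv_imgP=> g /(mem_ecommv q0 qs (@q_gen R) rM) cg ->; rewrite lfunE.
  apply/(uq_End_gcomm rW); rewrite PhiE.
  exact: (induced_map_gcomm q0 qs qa rM rN iE1 iF1 iE2 idg iinj pi sip E1n typical cg).
rewrite limg_dim_eq //; apply/eqP; rewrite -subv0; apply/subvP => g.
rewrite memv_cap memv_ker lfunE memv0 => /andP[_ /eqP g0]; apply/eqP.
apply: (induced_map_inj q0 qs qa rM rN iE1 iF1 iE2 idg iinj pi sip E1n typical).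
by rewrite -PhiE (g0 : Phi g = 0) mulmx0 mul0mx.
Qed.

End Dimension.

End Endomorphisms.

(** * The module V(0, alpha) *)

Section FourVectors.
Variables (k : fieldType) (d : nat).
Implicit Types (v : 'I_4 -> 'cV[k]_d).

Definition cols v : 'M[k]_(d, 4) := \matrix_(i, j) v j i 0.

Lemma mul_cols v (x : 'cV[k]_4) : cols v *m x = \sum_j x j 0 *: v j.
Proof.
apply/colP => i; rewrite !mxE summxE; apply: eq_bigr => j _.
by rewrite !mxE mulrC.
Qed.

Lemma mul_cols_intertwine v (A : 'M[k]_d) (A0 : 'M[k]_4) :
  (forall j, A *m v j = \sum_i A0 i j *: v i) -> A *m cols v = cols v *m A0.
Proof.
move=> e; apply/matrixP => i j.
have /colP/(_ i) : A *m v j = cols v *m col j A0.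
  by rewrite e mul_cols; apply: eq_bigr => l _; rewrite mxE.
by rewrite !mxE => h; rewrite (eq_bigr (fun l => A i l * v j l 0)) => [|l _];
  [rewrite h; apply: eq_bigr => l _; rewrite !mxE | rewrite mxE].
Qed.

(* The vectors v0, v1 = F2 v0, v2 = F1 v1, v3 = F2 v2 are independent because
   E2 E1 E2 brings v3, and only v3, back to a multiple of v0. *)
Lemma four_independent (E1 E2 F1 F2 : 'M[k]_d) (v0 v1 v2 v3 : 'cV[k]_d) (a b : k) :
  a != 0 -> b != 0 -> v0 != 0 ->
  F2 *m v0 = v1 -> F1 *m v1 = v2 -> F2 *m v2 = v3 ->
  F1 *m v0 = 0 -> F2 *m v1 = 0 -> F1 *m v2 = 0 -> F2 *m v3 = 0 ->
  E2 *m v0 = 0 -> E2 *m v1 = a *: v0 -> E2 *m v2 = 0 -> E2 *m v3 = b *: v2 ->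
  E1 *m v0 = 0 -> E1 *m v2 = v1 ->
  forall x0 x1 x2 x3, x0 *: v0 + x1 *: v1 + x2 *: v2 + x3 *: v3 = 0 ->
  [/\ x0 = 0, x1 = 0, x2 = 0 & x3 = 0].
Proof.
move=> a0 b0 v00 F20 F11 F22 F10 F21 F12 F23 E20 E21 E22 E23 E10 E12.
have top x0 x1 x2 x3 : x0 *: v0 + x1 *: v1 + x2 *: v2 + x3 *: v3 = 0 -> x3 = 0.
  move=> /(congr1 (fun w => E2 *m (E1 *m (E2 *m w)))).
  rewrite !mulmx0 !mulmxDr -!scalemxAr E20 E21 E22 E23 -!scalemxAr.
  by rewrite E10 E12 E21 !(mulmx0, scaler0, add0r) => /eqP; rewrite !scaler_eq0
    (negPf a0) (negPf b0) (negPf v00) !orbF => /eqP.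
move=> x0 x1 x2 x3 e; have z3 := top _ _ _ _ e.
rewrite z3 scale0r addr0 in e.
have z2 : x2 = 0.
  apply: (top 0 x0 0); have := congr1 (mulmx F2) e.
  by rewrite mulmx0 !mulmxDr -!scalemxAr F20 F21 F22 !scale0r scaler0 addr0 add0r addr0.
rewrite z2 scale0r addr0 in e.
have z1 : x1 = 0.
  apply: (top 0 0 0); have := congr1 (fun w => F2 *m (F1 *m w)) e.
  rewrite !mulmx0 mulmxDr -!scalemxAr F10 F11 scaler0 add0r -scalemxAr F22.
  by rewrite !scale0r !add0r.
rewrite z1 scale0r addr0 in e; split=> //.
by move/eqP: e; rewrite scaler_eq0 (negPf v00) orbF => /eqP.
Qed.

Lemma cols_inj (v0 v1 v2 v3 : 'cV[k]_d) :
  (forall x0 x1 x2 x3, x0 *: v0 + x1 *: v1 + x2 *: v2 + x3 *: v3 = 0 ->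
    [/\ x0 = 0, x1 = 0, x2 = 0 & x3 = 0]) ->
  forall x : 'cV[k]_4, cols (fun j => nth 0 [:: v0; v1; v2; v3] j) *m x = 0 -> x = 0.
Proof.
move=> indep x; rewrite mul_cols !big_ord_recl big_ord0 addr0 !addrA /=.
case/indep => e0 e1 e2 e3; apply/colP => -[[|[|[|[|//]]]] lt]; rewrite mxE.
- by rewrite -[RHS]e0; congr (x _ _); apply: val_inj.
- by rewrite -[RHS]e1; congr (x _ _); apply: val_inj.
- by rewrite -[RHS]e2; congr (x _ _); apply: val_inj.
- by rewrite -[RHS]e3; congr (x _ _); apply: val_inj.
Qed.

Lemma cols_delta v j : cols v *m delta_mx j 0 = v j.
Proof. by rewrite -colE; apply/colP => i; rewrite !mxE. Qed.

(** That d equals 4 is not assumed: bijectivity supplies a two-sided inverse of a matrix of a priori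
    rectangular shape. *)
Lemma cols_inverse v : (forall y : 'cV[k]_d, exists x, cols v *m x = y) ->
  (forall x : 'cV[k]_4, cols v *m x = 0 -> x = 0) ->
  exists2 B' : 'M[k]_(4, d), cols v *m B' = 1%:M & B' *m cols v = 1%:M.
Proof.
move=> surj inj.
have /fin_all_exists[f fE] : forall j : 'I_d, exists x : 'cV[k]_4,
    cols v *m x = (delta_mx j 0 : 'cV[k]_d) by move=> j; apply: surj.
pose B' : 'M[k]_(4, d) := \matrix_(i, j) f j i 0.
have BB' : cols v *m B' = 1%:M.
  apply/matrixP => i j; have /colP/(_ i) := fE j; rewrite !mxE eqxx andbT => <-.
  by apply: eq_bigr => l _; rewrite !mxE.
exists B' => //; apply/eqP; rewrite -subr_eq0; apply/eqP/matrixP => i j.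
have : cols v *m (col j (B' *m cols v - 1%:M)) = 0.
  by rewrite colE mulmxA mulmxBr mulmxA BB' mul1mx mulmx1 subrr mul0mx.
by move/inj/colP/(_ i); rewrite mxE => ->; rewrite !mxE.
Qed.

(** For x = F1 and y = F2 this gives F1 v2 = 0 and F1 v3 = 0; the second part holds since x y x y =
    y x y x. *)
Lemma qserre_highest (q : k) (x y : 'M[k]_d) (v : 'cV[k]_d) :
  q + q^-1 != 0 -> qserre q x y = 0 -> y *m y = 0 -> x *m v = 0 ->
  x *m (x *m (y *m v)) = 0 /\ x *m (y *m (x *m (y *m v))) = 0.
Proof.
move=> q2 sxy yy xv; split.
  have := congr1 (mulmx^~ v) sxy; rewrite /qserre /= mul0mx mulmxDl mulmxBl.
  by rewrite -scalemxAl -!mulmxA xv !mulmx0 scaler0 subr0 addr0.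
have := congr1 (mulmx^~ v) (qserre_comm q2 sxy yy).
by rewrite /= -!mulmxA xv !mulmx0.
Qed.

Lemma mul_cols_diag v (A : 'M[k]_d) (z : 'I_4 -> k) :
  (forall j, A *m v j = z j *: v j) -> A *m cols v = cols v *m diag_mx (\row_j z j).
Proof.
move=> e; apply/matrixP => i j; have /colP/(_ i) := e j.
rewrite mul_mx_diag !mxE mulrC => <-.
by apply: eq_bigr => l _; rewrite !mxE.
Qed.

Lemma mul_cols_gstd (q kap s : k) (E1 E2 F1 F2 P : 'M[k]_d)
    (v0 v1 v2 v3 : 'cV[k]_d) :
  F2 *m v0 = v1 -> F1 *m v1 = v2 -> F2 *m v2 = v3 ->
  F1 *m v0 = 0 -> F2 *m v1 = 0 -> F1 *m v2 = 0 -> F1 *m v3 = 0 -> F2 *m v3 = 0 ->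
  E2 *m v0 = 0 -> E2 *m v1 = qbr q kap *: v0 -> E2 *m v2 = 0 ->
  E2 *m v3 = qbr q (kap * q) *: v2 ->
  E1 *m v0 = 0 -> E1 *m v1 = 0 -> E1 *m v2 = v1 -> E1 *m v3 = 0 ->
  P *m F1 = F1 *m P -> P *m F2 = - (F2 *m P) -> P *m v0 = s *: v0 ->
  let S := gstd q kap s in let B := cols (fun j => nth 0 [:: v0; v1; v2; v3] j) in
  [/\ P *m B = B *m gP S, E1 *m B = B *m gE1 S, E2 *m B = B *m gE2 S,
      F1 *m B = B *m gF1 S & F2 *m B = B *m gF2 S].
Proof.
move=> F20 F11 F22 F10 F21 F12 F13 F23 E20 E21 E22 E23 E10 E11 E12 E13 PF1 PF2 P0 S B.
have P1 : P *m v1 = - s *: v1.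
  by rewrite -F20 mulmxA PF2 mulNmx -mulmxA P0 -scalemxAr scaleNr.
have P2 : P *m v2 = - s *: v2 by rewrite -F11 mulmxA PF1 -mulmxA P1 -scalemxAr.
have P3 : P *m v3 = s *: v3.
  by rewrite -F22 mulmxA PF2 mulNmx -mulmxA P2 -scalemxAr scaleNr opprK.
split.
- apply: mul_cols_diag => -[[|[|[|[|//]]]] ?] /=;
  by rewrite ?(P0, P1, P2, P3) ?exprN1 ?invrN1 ?expr0z ?expr1z ?mulrN1 ?mulr1.
- apply: mul_cols_intertwine => -[[|[|[|[|//]]]] ?];
  rewrite !big_ord_recl big_ord0 !mxE /=;
  by rewrite ?(E10, E11, E12, E13) ?scale0r ?scale1r ?addr0 ?add0r.
- apply: mul_cols_intertwine => -[[|[|[|[|//]]]] ?];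
  rewrite !big_ord_recl big_ord0 !mxE /=;
  by rewrite ?(E20, E21, E22, E23) ?mulr0n ?mulr1n ?addr0 ?add0r ?scale0r ?addr0 ?add0r.
- apply: mul_cols_intertwine => -[[|[|[|[|//]]]] ?];
  rewrite !big_ord_recl big_ord0 !mxE /=;
  by rewrite ?(F10, F11, F12, F13) ?scale0r ?scale1r ?addr0 ?add0r.
- apply: mul_cols_intertwine => -[[|[|[|[|//]]]] ?];
  rewrite !big_ord_recl big_ord0 !mxE /=;
  by rewrite ?(F20, F21, F22, F23) ?scale0r ?scale1r ?addr0 ?add0r.
Qed.

End FourVectors.

Section Simple.
Variable R : realType.
Local Notation C := (R[i]).
Local Notation k := (laurent R).
Local Notation q := (q R).
Variables (V : uqdata k) (alpha : C).
Hypothesis mV : uq_module V.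
Local Notation d := (udim V).
Local Notation E1 := (uE V ord0).
Local Notation E2 := (uE V ord_max).
Local Notation F1 := (uF V ord0).
Local Notation F2 := (uF V ord_max).
Local Notation h1 := (uh V ord0).
Local Notation h2 := (uh V ord_max).
Local Notation P := (parity_mx k (@upar _ V)).

Lemma uq_h_diag i : exists (B B' : 'M[k]_d) (z : 'I_d -> C),
  [/\ B *m B' = 1%:M, B' *m B = 1%:M & uh V i *m B = B *m diag_mx (\row_j cst (z j))].
Proof.
have [B uB wB] := uh_diag mV.
have /fin_all_exists[z zE] : forall j, exists a : C, uh V i *m col j B = cst a *: col j B.
  move=> j; have [a1 [a2 [e1 e2]]] := wB j.
  by move: i; apply: ord2P; [exists a1 | exists a2].
exists B, (invmx B), z; split; rewrite ?mulmxV ?mulVmx //.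
apply/matrixP => l j; have /colP/(_ l) := zE j.
by rewrite colE mulmxA -!colE mul_mx_diag !mxE mulrC.
Qed.

Lemma uq_qexp i (x : C) (v : 'cV[k]_d) : uh V i *m v = cst x *: v ->
  (qexp (uh V i) - qexp (- uh V i)) *m v = (qpow x - qpow (- x)) *: v.
Proof.
have [B [B' [z [BB' B'B hB]]]] := uq_h_diag i => hv.
rewrite mulmxBl (qexp_eigen BB' B'B hB hv).
rewrite (@qexp_eigen _ _ _ (- uh V i) B B' (fun j => - z j) BB' B'B _ (- x)).
- by rewrite scalerBl.
- rewrite mulNmx hB -mulmxN; congr (_ *m _).
  by apply/matrixP => l j; rewrite !mxE cstN mulNrn.
- by rewrite mulNmx hv cstN scaleNr.
Qed.

Lemma uq_hF i j (z : C) (v : 'cV[k]_d) : uh V i *m v = cst z *: v ->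
  uh V i *m (uF V j *m v) = cst (z - (cartan i j)%:~R) *: (uF V j *m v).
Proof.
move=> hv; have := uhF mV i j; rewrite (scomm_even_l _ (uh_par mV i)).
move=> /(canRL (subrK _)) /(congr1 (mulmx^~ v)); rewrite /= -mulmxA => ->.
by rewrite mulmxDl -mulmxA hv -scalemxAl -scalemxAr -scalerDl cstD cstN cst_int addrC.
Qed.

Lemma uq_EF1 (z : C) (v : 'cV[k]_d) : h1 *m v = cst z *: v ->
  E1 *m (F1 *m v) = F1 *m (E1 *m v) + qbr q (qpow z) *: v.
Proof.
move=> hv; have := uEF mV ord0 ord0.
rewrite (scomm_homogeneous (uE_par mV ord0) (uF_par mV ord0)) /= expr0 scale1r.
move=> /(canRL (subrK _)) /(congr1 (mulmx^~ v)); rewrite /= -mulmxA => ->.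
by rewrite mulmxDl -scalemxAl (uq_qexp hv) scalerA -qbr_qpow -mulmxA addrC.
Qed.

Lemma uq_EF2 (z : C) (v : 'cV[k]_d) : h2 *m v = cst z *: v ->
  E2 *m (F2 *m v) = - (F2 *m (E2 *m v)) + qbr q (qpow z) *: v.
Proof.
move=> hv; have := uEF mV ord_max ord_max.
rewrite (scomm_homogeneous (uE_par mV ord_max) (uF_par mV ord_max)) /= expr1 scaleN1r opprK.
move=> /(canRL (addrK _)) /(congr1 (mulmx^~ v)); rewrite /= -mulmxA => ->.
by rewrite mulmxBl -scalemxAl (uq_qexp hv) scalerA -qbr_qpow -mulmxA addrC.
Qed.

Lemma uq_EF12 (v : 'cV[k]_d) : E1 *m (F2 *m v) = F2 *m (E1 *m v).
Proof.
have := uEF mV ord0 ord_max.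
rewrite (scomm_homogeneous (uE_par mV ord0) (uF_par mV ord_max)) /= expr0 scale1r.
by move=> /subr0_eq e; rewrite !mulmxA e.
Qed.

Lemma uq_EF21 (v : 'cV[k]_d) : E2 *m (F1 *m v) = F1 *m (E2 *m v).
Proof.
have := uEF mV ord_max ord0.
rewrite (scomm_homogeneous (uE_par mV ord_max) (uF_par mV ord0)) /= expr0 scale1r.
by move=> /subr0_eq e; rewrite !mulmxA e.
Qed.

(* F1 acts nilpotently since it shifts the finitely many weights. *)
Lemma uq_F1_nil (z : C) (v : 'cV[k]_d) : h1 *m v = cst z *: v -> exists n, iter n (mulmx F1) v = 0.
Proof.
move=> hv; have [B [B' [w [BB' B'B hB]]]] := uq_h_diag ord0.
have hn n : h1 *m iter n (mulmx F1) v = cst (z - (2 * n)%N%:R) *: iter n (mulmx F1) v.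
  elim: n => [|n IH]; first by rewrite subr0.
  by rewrite iterS (uq_hF _ IH); congr (cst _ *: _); rewrite /cartan /= mulnS natrD; ring.
(* These are d + 1 distinct numbers, while h1 has at most d eigenvalues, so one of them is not an
   eigenvalue. *)
pose N := [seq z - (2 * n)%N%:R | n <- iota 0 d.+1].
have uN : uniq N.
  rewrite map_inj_uniq ?iota_uniq // => a b /addrI/oppr_inj/eqP.
  by rewrite eqr_nat; lia.
have [n _ nN] : exists2 n, n \in iota 0 d.+1 & z - (2 * n)%N%:R \notin codom w.
  apply/hasP; rewrite -[has _ _]negbK -all_predC; apply/negP => /allP al.
  have /(uniq_leq_size uN) : {subset N <= codom w}.
    by move=> _ /mapP[m /al /negPn ? ->].
  by rewrite size_map size_iota size_codom card_ord ltnn.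
exists n; set u := iter n _ v; have := hn n; rewrite -/u => hu.
have e : diag_mx (\row_j cst (w j)) *m (B' *m u) = cst (z - (2 * n)%N%:R) *: (B' *m u).
  have hB' : B' *m h1 = diag_mx (\row_j cst (w j)) *m B'.
    by rewrite -[LHS]mulmx1 -BB' mulmxA -(mulmxA B') hB mulmxA B'B mul1mx.
  by rewrite mulmxA -hB' -mulmxA hu -scalemxAr.
have u0 : B' *m u = 0.
  apply/colP => j; have /colP/(_ j) := e; rewrite mul_diag_mx !mxE => /eqP.
  rewrite -subr_eq0 -mulrBl mulf_eq0 subr_eq0 => /orP[/eqP/cst_inj wj|/eqP //].
  by move/negP: nN; case; have := codom_f w j; rewrite wj.
by rewrite -[u]mul1mx -BB' -mulmxA u0 mulmx0.
Qed.

End Simple.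

Section SimpleModule.
Variable R : realType.
Local Notation C := (R[i]).
Local Notation k := (laurent R).
Local Notation q := (q R).
Variables (V : uqdata k) (alpha : C).
Hypothesis sV : simple_module V.
Hypotheses (alpha_neq0 : alpha != 0) (alpha1_neq0 : alpha + 1 != 0).
Local Notation d := (udim V).
Local Notation E1 := (uE V ord0).
Local Notation E2 := (uE V ord_max).
Local Notation F1 := (uF V ord0).
Local Notation F2 := (uF V ord_max).
Local Notation h1 := (uh V ord0).
Local Notation h2 := (uh V ord_max).
Local Notation P := (parity_mx k (@upar _ V)).

Let mV : uq_module V. Proof. by case: sV. Qed.

Lemma uq_F1_highest (v : 'cV[k]_d) : h1 *m v = cst 0 *: v -> E1 *m v = 0 -> F1 *m v = 0.
Proof.
move=> hv; pose wtv (j : int) (x : 'cV[k]_d) := h1 *m x = cst (j + j)%:~R *: x.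
apply: (@sl2_invariant k q (q_neq0 R) (q_sub R) (@q_gen R) 'cV[k]_d
  (mulmx E1) (mulmx F1) wtv _ _ v _ hv).
- move=> j x wx; rewrite /wtv (uq_hF mV _ wx); congr (cst _ *: _).
  by rewrite /cartan /= -intrB; congr (_%:~R); lia.
- move=> j x wx /=; rewrite (uq_EF1 mV wx) addrAC subrr add0r.
  by rewrite qpow_int.
- exact: uq_F1_nil hv.
Qed.

Lemma parity_commutes : [/\ P *m E1 = E1 *m P, P *m E2 = - (E2 *m P),
  P *m F1 = F1 *m P, P *m F2 = - (F2 *m P) & forall i, P *m uh V i = uh V i *m P].
Proof.
split; [| | | |move=> i]; rewrite (homogeneous_parity (b := _) (uE_par mV _)) ||
  rewrite (homogeneous_parity (uF_par mV _)) || rewrite (homogeneous_parity (uh_par mV _));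
  by rewrite /= ?expr0 ?expr1 ?scale1r ?scaleN1r.
Qed.

(** The given vector need not be homogeneous. Both v + P v and v - P v satisfy the highest weight
    equations, and they cannot both vanish because their sum is 2 v. *)
Lemma homogeneous_highest : (exists v : 'cV[k]_d, highest_weight_vector 0 alpha v) ->
  exists2 s : k, s * s = 1 &
    exists2 v : 'cV[k]_d, P *m v = s *: v & highest_weight_vector 0 alpha v.
Proof.
have [PE1 PE2 _ _ Ph] := parity_commutes.
case=> v [v0 [wv1 wv2] Ev]; pose u (s : k) := v + s *: (P *m v).
have hu s : u s != 0 -> s * s = 1 ->
    P *m u s = s *: u s /\ highest_weight_vector 0 alpha (u s).
  move=> us ss; split; last split=> //.
  - rewrite /u mulmxDr -scalemxAr mulmxA parity_mxK mul1mx scalerDr scalerA ss scale1r.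
    by rewrite addrC.
  - split; rewrite /u mulmxDr -scalemxAr mulmxA -Ph -mulmxA ?wv1 ?wv2;
      by rewrite -scalemxAr scalerA mulrC -scalerA -scalerDr.
  - apply: ord2P; rewrite /u mulmxDr -scalemxAr mulmxA Ev add0r.
      by rewrite -PE1 -mulmxA Ev mulmx0 scaler0.
    have -> : E2 *m P = - (P *m E2) by rewrite PE2 opprK.
    by rewrite mulNmx -mulmxA Ev mulmx0 oppr0 scaler0.
have [u1|u1] := eqVneq (u 1) 0; last first.
  by exists 1; rewrite ?mulr1 //; have [||? ?] := hu 1; rewrite ?mulr1 //; exists (u 1).
have uN : u (-1) != 0.
  apply/eqP => uN; have : 2%:R *: v = 0.
    rewrite scaler_nat mulr2n -[RHS](addr0 (0 : 'cV[k]_d)) -{1}u1 -uN /u.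
    by rewrite scale1r scaleN1r addrACA subrr addr0.
  by move/eqP; rewrite scaler_eq0 (negPf (two_neq0 R)) (negPf v0).
by exists (-1); rewrite ?mulrNN ?mulr1 //; have [||? ?] := hu (-1);
  rewrite ?mulrNN ?mulr1 //; exists (u (-1)).
Qed.

(** The span of v, F2 v, F1 F2 v and F2 F1 F2 v is stable under all generators and under parity, so
    it is V by simplicity. The four vectors are independent because [alpha] and [alpha + 1] are
    nonzero. *)
Lemma V_realizes (s : k) (v : 'cV[k]_d) : P *m v = s *: v ->
  highest_weight_vector 0 alpha v ->
  exists B B', @realizes R V (gstd q (qpow alpha) s) alpha B B'.
Proof.
move=> Pv [v0 [hv1 hv2] Ev].
have F1v := uq_F1_highest hv1 (Ev ord0).
have [serre3 serre4] := qserre_highest (q_add R) (uF_serre mV) (uFF mV) F1v.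
have FF (w : 'cV[k]_d) : F2 *m (F2 *m w) = 0 by rewrite mulmxA (uFF mV) mul0mx.
have [_ _ PF1 PF2 _] := parity_commutes.
pose v1 := F2 *m v; pose v2 := F1 *m v1; pose v3 := F2 *m v2.
have w1 : h1 *m v1 = cst 1%:~R *: v1 /\ h2 *m v1 = cst (alpha + 0%:~R) *: v1.
  by split; rewrite (uq_hF mV _ hv1) || rewrite (uq_hF mV _ hv2);
    congr (cst _ *: _); rewrite /cartan /= ?mulrN1z ?mulr0z; ring.
have w2 : h1 *m v2 = cst (-1)%:~R *: v2 /\ h2 *m v2 = cst (alpha + 1%:~R) *: v2.
  by split; rewrite (uq_hF mV _ w1.1) || rewrite (uq_hF mV _ w1.2);
    congr (cst _ *: _); rewrite /cartan /= ?mulrN1z ?mulr0z; ring.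
have w3 : h1 *m v3 = cst 0%:~R *: v3 /\ h2 *m v3 = cst (alpha + 1%:~R) *: v3.
  by split; rewrite (uq_hF mV _ w2.1) || rewrite (uq_hF mV _ w2.2);
    congr (cst _ *: _); rewrite /cartan /= ?mulrN1z ?mulr0z; ring.
have E1v1 : E1 *m v1 = 0 by rewrite /v1 (uq_EF12 mV) Ev mulmx0.
have E1v2 : E1 *m v2 = v1.
  rewrite /v2 (uq_EF1 mV w1.1) E1v1 mulmx0 add0r qpow_int expr1z.
  by rewrite qbrq ?scale1r ?q_sub.
have E1v3 : E1 *m v3 = 0 by rewrite /v3 (uq_EF12 mV) E1v2 FF.
have E2v1 : E2 *m v1 = qbr q (qpow alpha) *: v.
  by rewrite /v1 (uq_EF2 mV hv2) Ev mulmx0 oppr0 add0r.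
have E2v2 : E2 *m v2 = 0 by rewrite /v2 (uq_EF21 mV) E2v1 -scalemxAr F1v scaler0.
have E2v3 : E2 *m v3 = qbr q (qpow alpha * q) *: v2.
  by rewrite /v3 (uq_EF2 mV w2.2) E2v2 mulmx0 oppr0 add0r qpowD.
have F2v1 : F2 *m v1 = 0 by exact: FF.
have F1v2 : F1 *m v2 = 0 by exact: serre3.
have F1v3 : F1 *m v3 = 0 by exact: serre4.
have F2v3 : F2 *m v3 = 0 by exact: FF.
pose S := gstd q (qpow alpha) s.
pose vv (j : 'I_4) := nth 0 [:: v; v1; v2; v3] j.
pose B := cols vv.
have [BP BE1 BE2 BF1 BF2] := mul_cols_gstd (erefl v1) (erefl v2) (erefl v3)
  F1v F2v1 F1v2 F1v3 F2v3 (Ev ord_max) E2v1 E2v2 E2v3 (Ev ord0) E1v1 E1v2 E1v3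
  PF1 PF2 Pv.
have Bh i : uh V i *m B = B *m hdiag S alpha i.
  apply: mul_cols_diag; move: i; apply: ord2P => -[[|[|[|[|//]]]] lt].
  - exact: hv1.
  - exact: w1.1.
  - exact: w2.1.
  - exact: w3.1.
  - by rewrite addr0; exact: hv2.
  - exact: w1.2.
  - exact: w2.2.
  - exact: w3.2.
have surj (y : 'cV[k]_d) : exists x, B *m x = y.
  pose mB : {linear 'cV[k]_4 -> 'cV[k]_d} := mulmx B.
  pose U : {vspace 'cV[k]_d} := limg (linfun mB).
  have memU w : w \in U <-> exists x, B *m x = w.
    split=> [/memv_imgP[x _ ->]|[x <-]]; first by exists x; rewrite lfunE.
    by apply/memv_imgP; exists x; rewrite ?memvf ?lfunE.
  have stab (A : 'M[k]_d) A0 : A *m B = B *m A0 -> forall w, w \in U -> A *m w \in U.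
    move=> AB w /memU[x <-]; apply/memU; exists (A0 *m x).
    by rewrite mulmxA -AB mulmxA.
  have subU : submodule V U.
    split; [exact: stab BP|apply: ord2P|apply: ord2P|move=> i; exact: stab (Bh i)].
    - exact: stab BE1.
    - exact: stab BE2.
    - exact: stab BF1.
    - exact: stab BF2.
  have vU : v \in U.
    by apply/memU; exists (delta_mx ord0 0); exact: cols_delta.
  have [_ _ /(_ U subU)] := sV; case=> Ue.
    by move: vU v0; rewrite Ue memv0 => ->.
  by apply/memU; rewrite Ue memvf.
have kb : qbr q (qpow alpha) != 0 by rewrite qbr_qpow_neq0.
have kqb : qbr q (qpow alpha * q) != 0 by rewrite -qpowD qbr_qpow_neq0.
have inj := cols_inj (four_independent kb kqb v0 (erefl v1) (erefl v2) (erefl v3)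
  F1v F2v1 F1v2 F2v3 (Ev ord_max) E2v1 E2v2 E2v3 (Ev ord0) E1v2).
have [B' BB' B'B] := cols_inverse surj inj.
exists B, B'; split; [exact: BB' | exact: B'B | by [] | exact: BP | exact: BE1 | exact: BE2
  | exact: BF1 | exact: BF2 | exact: Bh].
Qed.

End SimpleModule.

(** * The unit isomorphism between k (x) V and V *)

Section CastIdentity.
Variables (k : fieldType) (m n : nat) (e : m = n).

Lemma castmx1K :
  castmx (erefl m, e) (1%:M : 'M[k]_m) *m castmx (e, erefl m) 1%:M = 1%:M.
Proof. by case: n / e; rewrite !castmx_id mulmx1. Qed.

Lemma castmx1K' :
  castmx (e, erefl m) (1%:M : 'M[k]_m) *m castmx (erefl m, e) 1%:M = 1%:M.
Proof. by case: n / e; rewrite !castmx_id mulmx1. Qed.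

Lemma mul_castmx1 (A : 'M[k]_m) :
  A *m castmx (erefl m, e) 1%:M = castmx (erefl m, e) 1%:M *m castmx (e, e) A.
Proof. by case: n / e; rewrite !castmx_id mulmx1 mul1mx. Qed.

End CastIdentity.

Section TrivialFactor.
Variables (k : fieldType) (q : k) (S : gmod k).
Local Notation d := (gdim S).
Local Notation N := (gtens q (gtriv k) S).

(** [gpow] starts its products from the trivial module, whereas the first tensor power of V is V
    itself; this identity matrix, cast along 1 * d = d, bridges the two. *)
Definition unit_mx : 'M[k]_(d, gdim N) := castmx (erefl, esym (mul1n d)) 1%:M.
Definition unit_mx' : 'M[k]_(gdim N, d) := castmx (esym (mul1n d), erefl) 1%:M.

Lemma unit_mxK : unit_mx *m unit_mx' = 1%:M.
Proof. exact: castmx1K. Qed.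

Lemma unit_mx'K : unit_mx' *m unit_mx = 1%:M.
Proof. exact: castmx1K'. Qed.

Lemma unit_mx_tens (A : 'M[k]_d) : A *m unit_mx = unit_mx *m (1%:M *t A).
Proof. by rewrite (tens_scalar1mx A); exact: mul_castmx1. Qed.

Lemma unit_mx_deg : has_deg (@gwt _ S) (@gwt _ N) 0 unit_mx.
Proof.
move=> i l; rewrite castmxE !mxE addr0.
have [e _|_] := eqVneq (cast_ord _ i) _; last by rewrite eqxx.
rewrite /= /twt /= add0r; congr gwt; apply: val_inj => /=.
have := congr1 val e; rewrite /= => ->.
have lt_l : (l < 1 * d)%N := ltn_ord l.
by rewrite modn_small // -[X in (_ < X)%N]mul1n.
Qed.

Lemma unit_mx_gdiag g : gdiag S g *m unit_mx = unit_mx *m gdiag N g.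
Proof.
rewrite /gdiag (wdiag_deg _ unit_mx_deg); congr (_ *m _).
by apply: eq_wdiag => z; rewrite addr0.
Qed.

Lemma gtriv_tens_gens :
  [/\ gP N = 1%:M *t gP S, gE1 N = 1%:M *t gE1 S, gE2 N = 1%:M *t gE2 S,
      gF1 N = 1%:M *t gF1 S & gF2 N = 1%:M *t gF2 S].
Proof.
have tr1 (g : wt -> k) : g 0 = 1 -> gdiag (gtriv k) g = 1%:M.
  move=> g0; rewrite -(wdiag1 k (@gwt _ (gtriv k))); apply/matrixP => i j.
  by rewrite !mxE /= g0.
have L1 : gL1 q (gtriv k) = 1%:M by apply: tr1; rewrite /= oppr0 expr0z.
have P1 : gP (gtriv k) = 1%:M by apply: tr1; rewrite /= expr0z mulr1.
have L2 : gL2 q (gtriv k) = 1%:M by apply: tr1; rewrite /= oppr0 expr0z invr1 mulr1.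
split.
- by rewrite gP_tens P1.
- by rewrite /= tens0mx add0r L1.
- by rewrite /= tens0mx add0r L2 P1 mulmx1.
- by rewrite /= tens0mx add0r.
- by rewrite /= tens0mx add0r P1.
Qed.

End TrivialFactor.

Section Main.
Variable R : realType.
Local Notation C := (R[i]).
Local Notation k := (laurent R).
Local Notation q := (q R).

Lemma realizes_gtriv (V : uqdata k) (S : gmod k) c0 B B' :
  @realizes R V S c0 B B' ->
  exists D D', @realizes R V (gtens q (gtriv k) S) c0 D D'.
Proof.
move=> rV; exists (B *m unit_mx q S), (unit_mx' q S *m B').
have [P1 E1 E2 F1 F2] := gtriv_tens_gens q S.
split.
- by rewrite mulmxA -(mulmxA B) unit_mxK mulmx1 (r_BB' rV).
- by rewrite mulmxA -(mulmxA _ B') (r_B'B rV) mulmx1 unit_mx'K.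
- by rewrite /= mul1r (r_c rV).
- by rewrite mulmxA (r_P rV) P1 -!mulmxA unit_mx_tens.
- by rewrite mulmxA (r_E1 rV) E1 -!mulmxA unit_mx_tens.
- by rewrite mulmxA (r_E2 rV) E2 -!mulmxA unit_mx_tens.
- by rewrite mulmxA (r_F1 rV) F1 -!mulmxA unit_mx_tens.
- by rewrite mulmxA (r_F2 rV) F2 -!mulmxA unit_mx_tens.
- move=> i; rewrite mulmxA (r_h rV) -!mulmxA; congr (_ *m _).
  exact: (@unit_mx_gdiag k q S (fun z : wt => cst (if i == ord0 then z.1%:~R else c0 + z.2%:~R))).
Qed.

Lemma realizes_gpow (V : uqdata k) (alpha : C) s B B' n :
  @realizes R V (gstd q (qpow alpha) s) alpha B B' ->
  exists c0 D D', @realizes R (uq_tpow V n.+1) (gpow q (qpow alpha) s n.+1) c0 D D'.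
Proof.
move=> rV; elim: n => [|n [c0 [D [D' rD]]]].
  by have [D [D' rD]] := realizes_gtriv rV; exists alpha, D, D'.
by exists (c0 + alpha), (D *t B), (D' *t B'); exact: realizes_tens rD rV.
Qed.

End Main.

Theorem theorem1 (R : realType) (alpha : R[i])
    (halpha : forall r : rat, alpha <> ratr r)
    (V : uqdata (laurent R)) (hV : is_Vmod V 0 alpha) (n : nat) :
  (\dim (LG V n.+1))%:Q =
  ((2 * n)`! * (2 * n + 1)`!)%N%:Q / (((n`! * (n.+1)`!) ^ 2)%N%:Q).
Proof.
have [sV [v hv _]] := hV.
have a0 : alpha != 0.
  by have := irr_neq0 halpha 0 0; rewrite mul1r addr0.
have a1 : alpha + 1 != 0.
  by have := irr_neq0 halpha 0 1; rewrite mul1r.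
(* V is determined only up to parity shift; the sign s records the parity of its highest weight
   vector. *)
have [s ss [w Pw hw]] := homogeneous_highest sV (ex_intro _ v hv).
have [B [B' rV]] := V_realizes sV a0 a1 Pw hw.
have [c0 [D [D' rD]]] := realizes_gpow n rV.
have e := dim_ecommv_gpow n (q_neq0 R) (q_sub R) (@q_gen R) (qpow_neq0 alpha) ss.
rewrite -e -(dim_uq_End halpha ss rD) /LG.
by rewrite PoszM intrM mulfK // intr_eq0 -lt0n expn_gt0 muln_gt0 !fact_gt0.
Qed.
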